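(* There exists an absolute constant $K>0$ such that for every integer $n\ge 2$ there exists $w_0(n)$ such that for every $w>w_0(n)$ and every symmetric equilibrium $S$ of the game $G(n;w)$, $$\left|\frac{C_{n,w}(S)}{OPT(n,w)}-\frac{3}{2\sqrt 2}\right|\le \frac{K}{\sqrt n},$$ where $OPT(n,w)$ is the optimal symmetric social cost.
   Context: The game $G(n;w)$ ($n\ge 2$ an integer, $w>1$ real): there are $n$ agents and discrete time steps $t=1,2,3,\dots$. Initially all agents are outside an empty first-come-first-served queue. At each time step: (1) each agent still outside decides, simultaneously with the others and possibly using independent randomization, whether to enter the queue; (2) all agents who decided to enter are appended to the end of the queue in uniformly random order; (3) if the queue is nonempty, the first agent in it is processed and leaves, and each remaining agent in the queue incurs cost $w$; (4) each agent outside the queue incurs cost $1$. Each agent minimizes his expected total cost (possibly $+\infty$). The state at the start of a step is $(m,k)$, where $m\ge1$ agents are still outside and $k\ge 0$ agents are in the queue, $m+k\le n$. An anonymous stationary strategy specifies, for each state $(m,k)$, a probability $q_{m,k}\in[0,1]$ of entering, used whenever that state occurs. A profile is symmetric if all agents use the same strategy. A symmetric equilibrium is a symmetric profile of anonymous stationary strategies in which no agent can strictly decrease his expected cost by unilaterally deviating to another anonymous stationary strategy. $c_{n,w}(S)$ is the expected cost of each agent under the symmetric profile $S$, and $C_{n,w}(S)=n\cdot c_{n,w}(S)$ is the social cost. The optimal symmetric social cost is $OPT(n,w)=\inf_S C_{n,w}(S)$, the infimum over all symmetric profiles $S$ of anonymous stationary strategies (not necessarily equilibria). *)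

(* Defs.v *)
From mathcomp Require Import all_boot all_order all_algebra perm.
From mathcomp Require Import all_classical reals ereal sequences.

Set Implicit Arguments.
Unset Strict Implicit.
Unset Printing Implicit Defensive.

Import Order.TTheory GRing.Theory Num.Theory.
Local Open Scope ring_scope.

(* An anonymous stationary strategy: [q m k] is the probability of entering
   when m agents are outside and k agents are queueing. *)
Definition strategy (R : realType) := nat -> nat -> R.

Definition is_strategy (R : realType) (n : nat) (q : strategy R) : Prop :=
  forall m k, (0 < m)%N -> (m + k <= n)%N -> 0 <= q m k <= 1.

Definition profile (R : realType) (n : nat) := 'I_n -> strategy R.

(* Processed agents are neither outside nor in the queue; the head of [queue]
   is the next agent to be processed. *)
Record game_state (n : nat) := GameState {
  outside : {set 'I_n};
  queue : seq 'I_n }.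

Definition initial_state (n : nat) : game_state n := GameState [set: 'I_n] [::].

Definition enter_prob (R : realType) (n : nat) (P : profile R n)
    (st : game_state n) (i : 'I_n) : R :=
  P i #|outside st| (size (queue st)).

Definition entrants_prob (R : realType) (n : nat) (P : profile R n)
    (st : game_state n) (E : {set 'I_n}) : R :=
  \prod_(i in E) enter_prob P st i *
  \prod_(i in outside st :\: E) (1 - enter_prob P st i).

(* The agents of E join the queue in the order s, then the head of the queue
   is processed. *)
Definition next_state (n : nat) (st : game_state n) (E : {set 'I_n})
    (s : seq 'I_n) : game_state n :=
  GameState (outside st :\: E) (behead (queue st ++ s)).

(* Markov operator of one time step: [transition P f st] is the expectation of
   [f] at the state that follows [st] under the profile P. *)
Definition transition (R : realType) (n : nat) (P : profile R n)
    (f : game_state n -> R) (st : game_state n) : R :=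
  \sum_(E in powerset (outside st))
    entrants_prob P st E *
    (((#|E|)`!%:R)^-1 * \sum_(s <- permutations (enum E)) f (next_state st E s)).

(* The cost incurred by agent i in a time step, as a function of the state [st]
   reached at the end of that step. *)
Definition step_cost (R : realType) (n : nat) (w : R) (i : 'I_n)
    (st : game_state n) : R :=
  if i \in outside st then 1 else if i \in queue st then w else 0.

(* The t-th term is the expected cost of agent i in the (t+1)-st time step. *)
Definition expected_cost (R : realType) (n : nat) (w : R) (P : profile R n)
    (i : 'I_n) : \bar R :=
  (\sum_(0 <= t <oo)
     (iter t.+1 (transition P) (step_cost w i) (initial_state n))%:E)%E.

Definition symmetric_profile (R : realType) (n : nat) (S : strategy R)
  : profile R n := fun=> S.
Arguments symmetric_profile {R} n S.

Definition deviate (R : realType) (n : nat) (P : profile R n) (i : 'I_n)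
    (T : strategy R) : profile R n := fun j => if j == i then T else P j.

Definition symmetric_equilibrium (R : realType) (n : nat) (w : R)
    (S : strategy R) : Prop :=
  is_strategy n S /\
  forall (i : 'I_n) (T : strategy R), is_strategy n T ->
    (expected_cost w (symmetric_profile n S) i <=
     expected_cost w (deviate (symmetric_profile n S) i T) i)%E.

(* All agents have the same expected cost under a symmetric profile, so this is
   n times the expected cost of any of them: see [social_costE]. *)
Definition social_cost (R : realType) (n : nat) (w : R) (S : strategy R)
  : \bar R := (\sum_(i < n) expected_cost w (symmetric_profile n S) i)%E.

Definition optimal_social_cost (R : realType) (n : nat) (w : R) : \bar R :=
  ereal_inf [set social_cost n w S | S in @is_strategy R n]%classic.

Definition relabel (n : nat) (p : {perm 'I_n}) (st : game_state n) :=
  GameState (p @: outside st) (map p (queue st)).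

Lemma transition_relabel (R : realType) (n : nat) (S : strategy R)
    (p : {perm 'I_n}) (f g : game_state n -> R) :
  (forall st, f (relabel p st) = g st) ->
  forall st, transition (symmetric_profile n S) f (relabel p st) =
             transition (symmetric_profile n S) g st.
Proof.
move=> fg st; have pI : injective p := @perm_inj _ p.
have cardI (E : {set 'I_n}) : #|p @: E| = #|E| by rewrite card_imset.
have imD (A B : {set 'I_n}) : p @: (A :\: B) = (p @: A) :\: (p @: B).
  apply/setP => x; rewrite -[x](permKV p).
  by rewrite !(mem_imset, inE) ?(mem_imset, inE) //; apply: pI.
rewrite /transition (reindex (fun E : {set 'I_n} => p @: E)) /=; last first.
  exists (fun E : {set 'I_n} => p^-1%g @: E) => E _; rewrite -imset_comp.
    by under eq_imset do rewrite /= permK; rewrite imset_id.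
  by under eq_imset do rewrite /= permKV; rewrite imset_id.
apply: eq_big => [E|E _].
  rewrite !powersetE; apply/fintype.subsetP/fintype.subsetP => sEO x.
    by move=> xE; rewrite -(mem_imset _ _ pI) sEO ?imset_f.
  by case/imsetP => y yE ->; rewrite imset_f ?sEO.
congr (_ * _).
  rewrite /entrants_prob /enter_prob /= cardI size_map -imD /symmetric_profile.
  by rewrite !prodr_const !cardI.
rewrite cardI; congr (_ * _).
rewrite (perm_big (map (map p) (permutations (enum E)))) /=.
  rewrite big_map; apply: eq_bigr => s _; rewrite -fg.
  by rewrite /next_state /relabel /= -imD -map_cat behead_map.
apply: uniq_perm; first exact: permutations_uniq.
  by rewrite map_inj_uniq ?permutations_uniq //; apply: inj_map.
have pE : perm_eq (enum (p @: E)) (map p (enum E)).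
  apply: uniq_perm; rewrite ?enum_uniq ?map_inj_uniq ?enum_uniq // => x.
  rewrite mem_enum; apply/imsetP/mapP => -[y Ey ->]; exists y => //.
    by rewrite mem_enum.
  by rewrite mem_enum in Ey.
move=> s; rewrite mem_permutations (permPr pE).
apply/idP/mapP => [sE|[t]].
  exists (map p^-1%g s); last first.
    by rewrite (mapK (permKV p)).
  rewrite mem_permutations; have := perm_map p^-1%g sE.
  by rewrite (mapK (permK p)).
by rewrite mem_permutations => tE ->; apply: perm_map.
Qed.

Lemma social_costE (R : realType) (n : nat) (w : R) (S : strategy R)
    (i : 'I_n) :
  social_cost n w S =
  (n%:R%:E * expected_cost w (symmetric_profile n S) i)%E.
Proof.
rewrite /social_cost (eq_bigr
    (fun=> expected_cost w (symmetric_profile n S) i)); last first.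
  move=> j _; rewrite /expected_cost; apply: eq_eseriesr => t _; congr EFin.
  pose p := tperm i j.
  have init_p : relabel p (initial_state n) = initial_state n.
    congr GameState; apply/setP => x.
    by rewrite !inE -[x](permKV p) imset_f // inE.
  rewrite -[in LHS]init_p.
  elim: t.+1 (initial_state n) => [|m IH] st; last exact: transition_relabel.
  rewrite /= /step_cost /= -[j](tpermL i) -/p mem_imset; last exact: perm_inj.
  by rewrite mem_map //; exact: perm_inj.
rewrite big_const_ord mule_natl; move: (expected_cost _ _ _) => x.
by elim: {S i} n => [|[|m] IH] //=; rewrite ?adde0 //; rewrite /= in IH; rewrite IH.
Qed.

(* Main.v *)
Require Import Defs.
From mathcomp Require Import all_boot all_order all_algebra.
From mathcomp Require Import all_classical reals ereal sequences.
From mathcomp Require Import topology normedtype.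
From mathcomp Require Import zify ring lra.

Import Order.TTheory GRing.Theory Num.Theory.
Local Open Scope ring_scope.

(* An entrant's position among the simultaneous entrants is uniform, so the cost
   of an agent facing a symmetric profile is the limit of a value iteration on
   the states (m, k). With an empty queue and a small entry probability p, the
   entry cost is w (m - 1) p / 2, and entering a nonempty queue costs at least w.

   Optimum: moving from m to m - 1 outside agents costs the society about
   1 / p + (m - 1) w p / 2 >= sqrt (2 (m - 1) w), with equality for a suitable p.
   Hence OPT is sqrt (2 w) times the sum of sqrt j over j < n, up to O(n^2), that
   is about (2 / 3) sqrt (2 w) n^(3/2).

   Equilibrium: the states (m, 0) are reached with positive probability, so both
   actions are optimal there, and with x = (m - 1) p the cost c_m of an
   agent is w x / 2 and also about 1 / x + c_(m-1); thus
   c_m (c_m - c_(m-1)) is about w / 2, and c_n about sqrt (w n). *)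

(** * Expectations under a binomial law *)

Fixpoint binexp (R : realType) (p : R) (b : nat) (h : nat -> R) : R :=
  if b is b'.+1 then (1 - p) * binexp R p b' h + p * binexp R p b' (h \o S) else h 0%N.
Arguments binexp {R}.

Section BinomialExpectation.
Context {R : realType}.
Implicit Types (p c : R) (b : nat) (h g : nat -> R).

Lemma eq_binexp p b h g :
  (forall e, (e <= b)%N -> h e = g e) -> binexp p b h = binexp p b g.
Proof.
elim: b h g => [|b IH] h g hg /=; first exact: hg.
by rewrite (IH h g) 1?(IH (h \o S) (g \o S)) // => e eb; apply: hg => //; lia.
Qed.

Lemma binexp_le p b h g : 0 <= p <= 1 ->
  (forall e, (e <= b)%N -> h e <= g e) -> binexp p b h <= binexp p b g.
Proof.
move=> /andP[p0 p1]; elim: b h g => [|b IH] h g hg /=; first exact: hg.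
apply: lerD; apply: ler_wpM2l; rewrite ?subr_ge0 //; apply: IH => e eb.
  by apply: hg; lia.
exact: hg.
Qed.

Lemma binexp_cst p b c : binexp p b (fun=> c) = c.
Proof. by elim: b => [//|b IH] /=; rewrite /comp IH; ring. Qed.

Lemma binexpD p b h g :
  binexp p b (fun e => h e + g e) = binexp p b h + binexp p b g.
Proof.
elim: b h g => [//|b IH] h g /=.
by rewrite IH (IH (h \o S) (g \o S)); ring.
Qed.

Lemma binexpZ p b c h : binexp p b (fun e => c * h e) = c * binexp p b h.
Proof.
elim: b h => [//|b IH] h /=.
by rewrite IH (IH (h \o S)); ring.
Qed.

Lemma binexp_mean p b : binexp p b (fun e => e%:R) = b%:R * p.
Proof.
elim: b => [|b IH] /=; first by rewrite mul0r.
have -> : GRing.natmul 1 \o S = fun e : nat => e%:R + 1 :> R.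
  by apply/funext => e /=; rewrite -natr1.
by rewrite binexpD binexp_cst IH -natr1; ring.
Qed.

Lemma binexp_eq0 p b : binexp p b (fun e => (e == 0%N)%:R) = (1 - p) ^+ b.
Proof.
elim: b => [|b IH] //=; rewrite exprS IH.
have -> : (fun e : nat => (e == 0%N)%:R) \o S = fun=> 0 :> R by [].
by rewrite binexp_cst mulr0 addr0.
Qed.

Lemma binexp_eq1 p b :
  binexp p b (fun e => (e == 1%N)%:R) = b%:R * p * (1 - p) ^+ b.-1.
Proof.
elim: b => [|b IH] /=; first by rewrite !mul0r.
have -> : (fun e : nat => (e == 1%N)%:R) \o S
          = fun e : nat => (e == 0%N)%:R :> R by [].
rewrite binexp_eq0 IH -[b.+1%:R]natr1; case: b {IH} => [|b] /=; first by rewrite !expr0; ring.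
by rewrite exprS; move: (_ ^+ b) => x; ring.
Qed.

(** Double counting among [b + 1] independent agents: the left side sums, over the agents, the
    expectation restricted to the event that this agent stays out; on the right, [e] entrants in
    total leave [b + 1 - e] such agents. This converts costs per agent into costs of all the outside
    agents. *)
Lemma binexp_fail_bias p b h :
  b.+1%:R * (1 - p) * binexp p b h =
  binexp p b.+1 (fun e => (b.+1 - e)%:R * h e).
Proof.
elim: b h => [|b IH] h; first by rewrite /= /comp subnn subn0; ring.
set r := binexp _ b.+2 _; rewrite -natr1.
have -> : r = (1 - p) * binexp p b.+1 (fun e => (b.+2 - e)%:R * h e) +
    p * binexp p b.+1 (fun e => (b.+1 - e)%:R * (h \o S) e) by [].
rewrite -(IH (h \o S)) (_ : binexp p b.+1 (fun e => (b.+2 - e)%:R * h e) =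
    binexp p b.+1 (fun e => (b.+1 - e)%:R * h e + h e)); last first.
  apply: eq_binexp => e eb; rewrite subSn // -natr1; ring.
by rewrite binexpD -IH /=; ring.
Qed.

End BinomialExpectation.

Section Bernoulli.
Context {R : realType}.
Implicit Types (p : R) (b : nat).

Lemma onem_exp_ge p b : 0 <= p <= 1 -> 1 - b%:R * p <= (1 - p) ^+ b.
Proof.
move=> /andP[p0 p1]; elim: b => [|b IH]; first by rewrite mul0r subr0.
rewrite exprS -natr1; have b0 : 0 <= b%:R :> R by [].
have : (1 - p) * (1 - b%:R * p) <= (1 - p) * (1 - p) ^+ b.
  by apply: ler_wpM2l => //; lra.
by apply: le_trans; nra.
Qed.

(** Bounds the probability that nobody enters by [1 / (1 + x)], where [x = b p] is the expected
    number of entrants. The induction step is [(1 - p) (1 + (b + 1) p) <= 1 + b p]. *)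
Lemma onem_exp_le p b : 0 <= p <= 1 -> (1 - p) ^+ b * (1 + b%:R * p) <= 1.
Proof.
move=> /andP[p0 p1]; elim: b => [|b IH]; first by rewrite mul0r addr0 mulr1.
rewrite exprS -natr1; have b0 : 0 <= b%:R :> R by [].
have q0 : 0 <= (1 - p) ^+ b by rewrite exprn_ge0 // subr_ge0.
apply: le_trans IH; rewrite -mulrA mulrCA; apply: ler_wpM2l => //; nra.
Qed.

End Bernoulli.

(* [b] is the number of the other agents who are outside, so that the state is
   (b + 1, k) in the notation of [strategy]. An agent entering the queue is
   charged his expected waiting cost at once. *)
Definition bellman (R : realType) (w : R) (a s : nat -> nat -> R)
    (u : nat -> nat -> R) (b k : nat) : R :=
  a b k * (w * (k%:R + b%:R * s b k / 2)) +
  (1 - a b k) * (1 + binexp (s b k) b (fun e => u (b - e)%N (k + e).-1)).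
Arguments bellman {R}.

Definition value (R : realType) (w : R) (a s : nat -> nat -> R) (N : nat) :=
  iter N (bellman w a s) (fun _ _ => 0).
Arguments value {R}.

Definition is_prob (R : realType) (a : nat -> nat -> R) :=
  forall b k, 0 <= a b k <= 1.
Arguments is_prob {R}.

(** * Comparison principles for the value iteration *)

Section Bellman.
Context {R : realType}.
Variables (w : R) (a s : nat -> nat -> R).
Hypotheses (w0 : 0 <= w) (pa : is_prob a) (ps : is_prob s).
Implicit Types (u v f g : nat -> nat -> R).

Lemma entry_cost_ge0 b k : 0 <= w * (k%:R + b%:R * s b k / 2).
Proof.
have /andP[s0 _] := ps b k.
by rewrite mulr_ge0 // addr_ge0 // divr_ge0 // mulr_ge0.
Qed.

Lemma bellman_le u v b k :
  (forall b' k', (b' <= b)%N -> u b' k' <= v b' k') ->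
  bellman w a s u b k <= bellman w a s v b k.
Proof.
move=> uv; have /andP[a0 a1] := pa b k.
rewrite /bellman lerD2l; apply: ler_wpM2l; first by rewrite subr_ge0.
by rewrite lerD2l; apply: binexp_le => // e _; apply: uv; rewrite leq_subr.
Qed.

Lemma bellman_ge0 u b k : (forall b' k', 0 <= u b' k') ->
  0 <= bellman w a s u b k.
Proof.
move=> u0; have /andP[a0 a1] := pa b k.
have e0 := entry_cost_ge0 b k.
have : binexp (s b k) b (fun=> 0) <= binexp (s b k) b (fun e => u (b - e)%N (k + e).-1).
  by apply: binexp_le.
rewrite binexp_cst /bellman => h0.
by rewrite addr_ge0 // mulr_ge0 // ?subr_ge0 // addr_ge0.
Qed.

Lemma valueS N b k : value w a s N.+1 b k = bellman w a s (value w a s N) b k.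
Proof. by []. Qed.

Lemma value_ge0 N b k : 0 <= value w a s N b k.
Proof. by elim: N b k => [|N IH] b k //; apply: bellman_ge0. Qed.

Lemma value_homo N M b k : (N <= M)%N -> value w a s N b k <= value w a s M b k.
Proof.
elim: N M b k => [|N IH] [|M] b k //; first by move=> _; apply: value_ge0.
by rewrite ltnS => NM; apply: bellman_le => b' k' _; apply: IH.
Qed.

(** The iteration starts from 0, below [g], and the monotone operator keeps it there. The range
    [b <= B] suffices because the number of outside agents never grows. *)
Lemma value_le_super B g N b k :
  (forall b k, (b <= B)%N -> 0 <= g b k) ->
  (forall b k, (b <= B)%N -> bellman w a s g b k <= g b k) ->
  (b <= B)%N -> value w a s N b k <= g b k.
Proof.
move=> g0 gs; elim: N b k => [|N IH] b k bB; first exact: g0.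
apply: le_trans (gs _ _ bB); apply: bellman_le => b' k' b'b.
by apply: IH; apply: leq_trans bB.
Qed.

(* The factor N / (N + M) absorbs the event that the agent is still outside
   after N steps, on which a cost of at least N has already been paid. *)
Lemma value_ge_sub B M f N b k : 0 < M ->
  (forall b k, (b <= B)%N -> f b k <= M) ->
  (forall b k, (b <= B)%N -> f b k <= bellman w a s f b k) ->
  (b <= B)%N -> N%:R / (N%:R + M) * f b k <= value w a s N b k.
Proof.
move=> M0 fM fs; elim: N b k => [|N IH] b k bB; first by rewrite mul0r mul0r.
have /andP[a0 a1] := pa b k; have /andP[s0 s1] := ps b k.
have e0 := entry_cost_ge0 b k.
have N0 : 0 <= N%:R :> R by [].
set c := N%:R / (N%:R + M) in IH *; set c' := N.+1%:R / (N.+1%:R + M).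
have NM0 : 0 < N%:R + M by lra.
have NM1 : 0 < N.+1%:R + M by rewrite -natr1; lra.
have c'0 : 0 <= c' by rewrite divr_ge0 // ltW.
have c'1 : c' <= 1 by rewrite ler_pdivrMr //; lra.
set y := binexp (s b k) b (fun e => f (b - e)%N (k + e).-1).
have yM : y <= M.
  rewrite -[leRHS](binexp_cst (s b k) b); apply: binexp_le => // e _; apply: fM.
  by rewrite (leq_trans (leq_subr _ _)).
have c'y : c' * (1 + y) <= 1 + c * y.
  (* The last fraction is nonnegative because [y <= M]: the unit cost of waiting pays for the
     increase of the factor from [c] to [c']. *)
  have -> : 1 + c * y = c' * (1 + y) +
      M * (N%:R + M - y) / ((N%:R + M) * (N.+1%:R + M)).
    rewrite /c /c' -natr1; field; rewrite !gt_eqF //.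
    by move: NM1; rewrite -natr1.
  rewrite lerDl; apply: divr_ge0; apply: mulr_ge0; lra.
apply: (le_trans (ler_wpM2l c'0 (fs b k bB))).
rewrite valueS /bellman mulrDr mulrCA [c' * (_ * (1 + _))]mulrCA.
apply: lerD; apply: ler_wpM2l => //; rewrite ?subr_ge0 //.
  by rewrite -[leRHS]mul1r; apply: ler_wpM2r.
apply: (le_trans c'y); rewrite lerD2l -binexpZ; apply: binexp_le => // e _.
by apply: IH; rewrite (leq_trans (leq_subr _ _)).
Qed.

End Bellman.

(** * Random sets of entrants and random orders *)

Section SubsetSums.
Context {R : realType} {I : finType}.

Lemma sum_powersetD1 (F : {set I} -> R) (O : {set I}) (x : I) : x \in O ->
  \sum_(E in powerset O) F E =
  \sum_(E in powerset (O :\ x)) (F E + F (x |: E)).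
Proof.
move=> xO; rewrite big_split /= (bigID (fun E : {set I} => x \notin E)) /=.
congr (_ + _).
  by apply: eq_bigl => E; rewrite !powersetE finset.subsetD1.
rewrite (reindex_onto (fun E => x |: E) (fun E => E :\ x)) /=; last first.
  by move=> E; rewrite negbK => /andP[_ xE]; apply: finset.setD1K.
apply: eq_bigl => E; rewrite !powersetE negbK finset.subUset
  finset.sub1set xO finset.setU11 andbT /=.
rewrite finset.subsetD1; congr (_ && _).
apply/eqP/idP => [<-|xE]; first by rewrite !inE eqxx.
by apply: finset.setU1K.
Qed.

Lemma sum_powerset_binexp (q : R) (O : {set I}) (h : nat -> R) :
  \sum_(E in powerset O) q ^+ #|E| * (1 - q) ^+ #|O :\: E| * h #|E| =
  binexp q #|O| h.
Proof.
have [m mO] := ubnP #|O|; elim: m => // m IH in O h mO *.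
have [->|[x xO]] := set_0Vmem O.
  rewrite powerset0 big_set1 finset.setD0 cards0 /=; ring.
rewrite (sum_powersetD1 _ _ _ xO) (cardsD1 x O) xO /= big_split /=.
have cO : (#|O :\ x| < m)%N by move: mO; rewrite (cardsD1 x O) xO.
rewrite -!IH // !big_distrr /=; congr (_ + _); apply: eq_bigr => E.
all: rewrite powersetE finset.subsetD1 => /andP[EO xE].
  have -> : O :\: E = x |: ((O :\ x) :\: E).
    apply/setP => y; rewrite !inE; case: eqVneq => [->|//]; by rewrite xE xO.
  by rewrite cardsU1 !inE eqxx andbF /= exprS; ring.
have -> : O :\: (x |: E) = (O :\ x) :\: E.
  by apply/setP => y; rewrite !inE negb_or -andbA; case: (y == x); rewrite /= ?andbF.
by rewrite cardsU1 xE /= exprS; ring.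
Qed.

End SubsetSums.

(** The waiting cost telescopes: an agent at a positive position pays [w] and moves up by one place,
    while the head leaves for free. *)
Lemma behead_index (T : eqType) (R : realType) (w : R) (x : T) (s : seq T) :
  uniq s -> x \in s ->
  (if x \in behead s then w + w * (index x (behead s))%:R else 0) =
  w * (index x s)%:R.
Proof.
case: s => [//|y s] /= /andP[ys us]; rewrite inE; have [<-|_] /= := eqVneq y x.
  by rewrite (negbTE ys) mulr0.
by move=> ->; rewrite -natr1; ring.
Qed.

Section PermutationAverage.
Context {R : realType} {I : finType}.
Implicit Types (E : {set I}) (f : seq I -> R).

Definition perm_avg E f : R :=
  ((#|E|)`!%:R)^-1 * \sum_(s <- permutations (enum E)) f s.

Lemma eq_perm_avg E f g :
  (forall s, perm_eq s (enum E) -> f s = g s) -> perm_avg E f = perm_avg E g.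
Proof.
move=> fg; congr (_ * _); rewrite big_seq [RHS]big_seq.
by apply: eq_bigr => s; rewrite mem_permutations => /fg.
Qed.

Lemma perm_avg_le E f g :
  (forall s, perm_eq s (enum E) -> f s <= g s) -> perm_avg E f <= perm_avg E g.
Proof.
move=> fg; apply: ler_wpM2l; first by rewrite invr_ge0.
rewrite big_seq [leRHS]big_seq.
by apply: ler_sum => s; rewrite mem_permutations => /fg.
Qed.

Lemma perm_avg_cst E (c : R) : perm_avg E (fun=> c) = c.
Proof.
rewrite /perm_avg big_const_seq count_predT size_permutations ?enum_uniq //.
by rewrite -cardE iter_addr addr0 -[c *+ _]mulr_natl mulrA mulVf ?mul1r //.
Qed.

(* Reversal exchanges the numbers of elements before and after [i]. *)
Lemma perm_avg_index E (i : I) : i \in E ->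
  perm_avg E (fun s => (index i s)%:R) = (#|E|.-1)%:R / 2.
Proof.
move=> iE; set A := perm_avg _ _.
have revA : A = perm_avg E (fun s => (index i (rev s))%:R).
  rewrite /A /perm_avg; congr (_ * _).
  rewrite (perm_big (map rev (permutations (enum E)))) /= ?big_map //.
  apply: uniq_perm; first exact: permutations_uniq.
    by rewrite map_inj_uniq ?permutations_uniq //; apply: (can_inj revK).
  move=> s; rewrite mem_permutations; apply/idP/mapP => [sE|[t]].
    by exists (rev s); rewrite ?revK // mem_permutations perm_rev.
  by rewrite mem_permutations => tE ->; rewrite perm_rev.
suff : A + A = (#|E|.-1)%:R by lra.
rewrite {2}revA /A -mulrDr -big_split /=.
rewrite -[RHS](perm_avg_cst E); apply: eq_perm_avg => s sE.
have is_ : i \in s by rewrite (perm_mem sE) mem_enum.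
have us : uniq s by rewrite (perm_uniq sE) enum_uniq.
rewrite -natrD; congr (_%:R); rewrite cardE -(perm_size sE).
case/splitPr: is_ us => s1 s2; rewrite cat_uniq /= negb_or => /and3P[_ /andP[is1 _]].
case/andP=> is2 _; rewrite rev_cat rev_cons cat_rcons.
rewrite !index_pivot ?mem_rev // size_rev size_cat /=; lia.
Qed.

End PermutationAverage.

(** * The game as a Markov chain on well-formed states *)

Lemma transitionE (R : realType) (n : nat) (P : profile R n) f st :
  transition P f st = \sum_(E in powerset (outside st)) entrants_prob P st E *
    perm_avg E (fun s => f (next_state st E s)).
Proof. by []. Qed.

Lemma transitionD (R : realType) (n : nat) (P : profile R n) f g st :
  transition P (fun x => f x + g x) st = transition P f st + transition P g st.
Proof.
rewrite /transition -big_split /=; apply: eq_bigr => E _.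
by rewrite big_split /= !mulrDr.
Qed.

Lemma transition0 (R : realType) (n : nat) (P : profile R n) st :
  transition P (fun=> 0) st = 0.
Proof.
by rewrite transitionE big1 // => E _; rewrite perm_avg_cst mulr0.
Qed.

(** Invariant of the reachable states. It implies [m + k <= n], the range in which [is_strategy]
    guarantees probabilities. *)
Definition wf_state (n : nat) (st : game_state n) :=
  uniq (queue st) && [disjoint queue st & outside st].
Arguments wf_state {n}.

Section WellFormed.
Context {n : nat}.
Implicit Types (st : game_state n) (E : {set 'I_n}) (s : seq 'I_n).

Lemma wf_initial : wf_state (initial_state n).
Proof. by rewrite /wf_state /=; apply/pred0P => x. Qed.

Lemma wf_card st : wf_state st -> (#|outside st| + size (queue st) <= n)%N.
Proof.
case/andP=> uq dq; rewrite addnC -(card_uniqP uq).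
have := cardUI (mem (queue st)) (mem (outside st)).
rewrite (_ : #|[predI _ & _]| = 0%N) ?addn0; last by apply: eq_card0; apply/pred0P.
by move=> <-; rewrite -[leqRHS]card_ord max_card.
Qed.

Lemma wf_cat_uniq st E s : wf_state st -> E \subset outside st ->
  perm_eq s (enum E) -> uniq (queue st ++ s).
Proof.
case/andP=> uq dq EO sE; rewrite cat_uniq uq (perm_uniq sE) enum_uniq andbT /=.
apply/hasPn => x; rewrite (perm_mem sE) mem_enum => xE.
apply/negP => /= xq; move/pred0P: dq => /(_ x) /=.
by rewrite xq (fintype.subsetP EO).
Qed.

Lemma wf_next st E s : wf_state st -> E \subset outside st ->
  perm_eq s (enum E) -> wf_state (next_state st E s).
Proof.
move=> wst EO sE; have us := wf_cat_uniq _ _ _ wst EO sE.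
apply/andP; split => /=; first by case: (_ ++ _) us => //= a l /andP[].
case/andP: wst => _ /pred0P dq.
apply/pred0P => x /=; apply/negP => /andP[/mem_behead]; rewrite mem_cat !inE.
case/orP => [xq|]; first by case/andP=> _ xO; have := dq x; rewrite /= xq xO.
by rewrite (perm_mem sE) mem_enum => ->.
Qed.

End WellFormed.

(** * Reduction of the game to the value iteration *)

Section Reduction.
Context {R : realType} {n : nat}.
Variables (w : R) (i : 'I_n) (S T : strategy R).
Hypotheses (w0 : 0 <= w) (hS : is_strategy n S) (hT : is_strategy n T).

Let P := deviate (symmetric_profile n S) i T.
Implicit Types (st : game_state n) (E : {set 'I_n}) (f g : game_state n -> R).

Lemma enter_prob01 st j : wf_state st -> j \in outside st ->
  0 <= enter_prob P st j <= 1.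
Proof.
move=> wst jO; have c0 : (0 < #|outside st|)%N by apply/card_gt0P; exists j.
rewrite /enter_prob /P /deviate /symmetric_profile; case: ifP => _.
  exact/hT/wf_card.
exact/hS/wf_card.
Qed.

Lemma entrants_prob_ge0 st E : wf_state st -> E \subset outside st ->
  0 <= entrants_prob P st E.
Proof.
move=> wst EO; apply: mulr_ge0; apply: prodr_ge0 => j.
  by move=> /(fintype.subsetP EO) /(enter_prob01 _ _ wst) /andP[].
by case/finset.setDP => /(enter_prob01 _ _ wst) /andP[_ ?] _; rewrite subr_ge0.
Qed.

Lemma transition_le st f g : wf_state st ->
  (forall st', wf_state st' -> f st' <= g st') ->
  transition P f st <= transition P g st.
Proof.
move=> wst fg; rewrite !transitionE; apply: ler_sum => E; rewrite powersetE => EO.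
apply: ler_wpM2l; first exact: entrants_prob_ge0.
by apply: perm_avg_le => s sE; apply: fg; apply: wf_next.
Qed.

Lemma eq_transition st f g : wf_state st ->
  (forall st', wf_state st' -> f st' = g st') ->
  transition P f st = transition P g st.
Proof.
move=> wst fg; rewrite !transitionE; apply: eq_bigr => E; rewrite powersetE => EO.
by congr (_ * _); apply: eq_perm_avg => s sE; apply: fg; apply: wf_next.
Qed.

Lemma entrants_prob_others st E : i \notin outside st -> E \subset outside st ->
  let q := S #|outside st| (size (queue st)) in
  entrants_prob P st E = q ^+ #|E| * (1 - q) ^+ #|outside st :\: E|.
Proof.
move=> iO EO q; rewrite /entrants_prob -!prodr_const; congr (_ * _).
all: apply: eq_bigr => j jE; rewrite /enter_prob /P /deviate ifN //.
  by apply: contraNneq iO => <-; apply: (fintype.subsetP EO).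
by apply: contraNneq iO => <-; case/finset.setDP: jE.
Qed.

Lemma entrants_prob_stay st E : i \in outside st -> E \subset outside st :\ i ->
  let q := S #|outside st| (size (queue st)) in
  entrants_prob P st E = (1 - T #|outside st| (size (queue st))) *
    (q ^+ #|E| * (1 - q) ^+ #|(outside st :\ i) :\: E|).
Proof.
move=> iO; rewrite finset.subsetD1 => /andP[EO iE] q.
rewrite /entrants_prob [X in _ * X](bigD1 i) /=; last by rewrite inE iO iE.
rewrite {2}/enter_prob {2}/P /deviate eqxx mulrCA; congr (_ * _).
rewrite -!prodr_const; congr (_ * _).
  apply: eq_bigr => j jE; rewrite /enter_prob /P /deviate ifN //.
  by apply: contraNneq iE => <-.
apply: eq_big => [j|j /andP[_ ji]]; last by rewrite /enter_prob /P /deviate ifN.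
by rewrite !inE andbA; case: (j \in E) => //=; rewrite andbC.
Qed.

Lemma entrants_prob_enter st E : i \in outside st -> E \subset outside st :\ i ->
  let q := S #|outside st| (size (queue st)) in
  entrants_prob P st (i |: E) = T #|outside st| (size (queue st)) *
    (q ^+ #|E| * (1 - q) ^+ #|(outside st :\ i) :\: E|).
Proof.
move=> iO; rewrite finset.subsetD1 => /andP[EO iE] q.
rewrite /entrants_prob big_setU1 //= {1}/enter_prob {1}/P /deviate eqxx -mulrA.
congr (_ * _); rewrite -!prodr_const; congr (_ * _).
  apply: eq_bigr => j jE; rewrite /enter_prob /P /deviate ifN //.
  by apply: contraNneq iE => <-.
apply: eq_big => [j|j]; last first.
  by rewrite !inE negb_or /enter_prob /P /deviate => /andP[/andP[/negPf -> _] _].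
by rewrite !inE negb_or; case: (j \in E); rewrite ?andbF ?andbT.
Qed.

(** Serves the states in which agent [i] has already entered: the behaviour of the others no longer
    affects his cost, and their probabilities sum to 1. *)
Lemma transition_cst st f (c : R) : i \notin outside st ->
  (forall E s, E \subset outside st -> perm_eq s (enum E) ->
     f (next_state st E s) = c) ->
  transition P f st = c.
Proof.
move=> iO fc; pose q := S #|outside st| (size (queue st)).
rewrite transitionE -[RHS](binexp_cst q #|outside st|) -sum_powerset_binexp.
apply: eq_bigr => E; rewrite powersetE => EO.
rewrite entrants_prob_others //; congr (_ * _).
by rewrite -[RHS](perm_avg_cst E); apply: eq_perm_avg => s sE; apply: fc.
Qed.

(** The argument of [u] counts the other outside agents, hence the predecessor. The index in the
    queue is the number of steps in which [w] is still to be paid. *)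
Definition cost_to_go (u : nat -> nat -> R) st : R :=
  if i \in outside st then u #|outside st|.-1 (size (queue st))
  else if i \in queue st then w * (index i (queue st))%:R else 0.

Let cost_ge0 st : 0 <= step_cost w i st.
Proof. by rewrite /step_cost; case: ifP => // _; case: ifP. Qed.

Lemma cost_to_go_ge0 u st : (forall b k, 0 <= u b k) -> 0 <= cost_to_go u st.
Proof.
move=> u0; rewrite /cost_to_go; case: ifP => // _.
by case: ifP => // _; rewrite mulr_ge0.
Qed.

(** Given the decision of [i], the number of entrants among the others is binomial; if [i] enters
    with [e] others, he has on average [e / 2] of them ahead of him. The strategies need to agree
    with [a] and [s] only at states that can occur. *)
Lemma transition_cost_to_go (a s u : nat -> nat -> R) st :
  (forall b k, (b + k < n)%N -> T b.+1 k = a b k /\ S b.+1 k = s b k) ->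
  wf_state st ->
  transition P (fun st => step_cost w i st + cost_to_go u st) st =
  cost_to_go (bellman w a s u) st.
Proof.
move=> ha wst; have us := wf_cat_uniq _ _ _ wst.
have cq E t : E \subset outside st -> perm_eq t (enum E) ->
    i \notin outside st :\: E -> i \in queue st ++ t ->
    step_cost w i (next_state st E t) + cost_to_go u (next_state st E t) =
    w * (index i (queue st ++ t))%:R.
  move=> EO tE iO iq; rewrite -behead_index //; last exact: us tE.
  by rewrite /step_cost /cost_to_go /= (negbTE iO); case: ifP; rewrite ?addr0.
rewrite {2}/cost_to_go; case: ifPn => iO; last first.
  apply: transition_cst => // E t EO tE.
  have iOE : i \notin outside st :\: E by rewrite inE (negbTE iO) andbF.
  case: ifPn => iq; first by rewrite cq ?mem_cat ?iq // index_cat iq.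
  have iE : i \notin E by apply: contraNN iO => /(fintype.subsetP EO).
  have iq' : i \notin behead (queue st ++ t).
    apply/negP => /mem_behead; rewrite mem_cat (negbTE iq) (perm_mem tE) mem_enum.
    by rewrite (negbTE iE).
  by rewrite /step_cost /cost_to_go /= (negbTE iOE) (negbTE iq') addr0.
have := wf_card _ wst; rewrite (cardsD1 i) iO.
set b := #|outside st :\ i|; set k := size (queue st) => bkn.
have [Ta Ss] := ha b k bkn.
have bE : #|outside st| = b.+1 by rewrite (cardsD1 i) iO.
rewrite transitionE (sum_powersetD1 _ _ _ iO) /= /bellman.
rewrite -[in RHS]Ta -[in RHS]Ss.
set q := S b.+1 k; set p := T b.+1 k.
(* Each set [E] of other entrants is paired with [i |: E], which separates waiting from entering. *)
transitivity (\sum_(E in powerset (outside st :\ i))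
  (p * (q ^+ #|E| * (1 - q) ^+ #|(outside st :\ i) :\: E| *
       (w * k%:R + w / 2 * #|E|%:R)) +
   (1 - p) * (q ^+ #|E| * (1 - q) ^+ #|(outside st :\ i) :\: E| *
       (1 + u (b - #|E|)%N (k + #|E|).-1)))); last first.
  rewrite big_split /= -!mulr_sumr.
  rewrite (sum_powerset_binexp q (outside st :\ i) (fun e => w * k%:R + w / 2 * e%:R)).
  rewrite (sum_powerset_binexp q (outside st :\ i)
     (fun e => 1 + u (b - e)%N (k + e).-1)).
  rewrite !binexpD !binexp_cst binexpZ binexp_mean -/b; congr (_ * _ + _); ring.
apply: eq_bigr => E; rewrite powersetE => EO'.
have := EO'; rewrite finset.subsetD1 => /andP[EO iE].
have iEO : i |: E \subset outside st by rewrite finset.subUset finset.sub1set iO EO.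
have bE' : #|outside st :\: E| = (b - #|E|).+1.
  rewrite cardsD (finset.setIidPr EO) bE subSn //.
  exact: subset_leq_card EO'.
rewrite entrants_prob_stay // entrants_prob_enter // bE -/k -/p -/q.
have -> : perm_avg E (fun t => step_cost w i (next_state st E t) +
    cost_to_go u (next_state st E t)) = 1 + u (b - #|E|)%N (k + #|E|).-1.
  rewrite -[RHS](perm_avg_cst E); apply: eq_perm_avg => t tE.
  rewrite /step_cost /cost_to_go /= inE iO iE /= bE' /=.
  by rewrite size_behead size_cat (perm_size tE) -cardE.
have -> : perm_avg (i |: E) (fun t => step_cost w i (next_state st (i |: E) t) +
    cost_to_go u (next_state st (i |: E) t)) = w * k%:R + w / 2 * #|E|%:R.
  have iq : i \notin queue st.
    apply/negP => iq; case/andP: wst => _ /pred0P /(_ i) /=; by rewrite iq iO.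
  rewrite (@eq_perm_avg _ _ _ _ (fun t => w * k%:R + w * (index i t)%:R)).
    have -> : w / 2 * #|E|%:R = w * perm_avg (i |: E) (fun t => (index i t)%:R).
      by rewrite perm_avg_index ?finset.setU11 // cardsU1 iE /=; ring.
    rewrite /perm_avg big_split /= mulrDr -[X in X + _]/(perm_avg _ _) perm_avg_cst.
    by rewrite -mulr_sumr mulrCA.
  move=> t tE; rewrite cq //; last 2 first.
  - by rewrite !inE eqxx.
  - by rewrite mem_cat (perm_mem tE) mem_enum finset.setU11 orbT.
  by rewrite index_cat (negbTE iq) natrD mulrDr.
ring.
Qed.

Definition cost_step f st := transition P (fun x => step_cost w i x + f x) st.

Definition cost_before N st : R :=
  \sum_(t < N) iter t.+1 (transition P) (step_cost w i) st.

Lemma iter_cost_step N f st :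
  iter N cost_step f st = cost_before N st + iter N (transition P) f st.
Proof.
elim: N st => [|N IH] st; first by rewrite /cost_before big_ord0 add0r.
rewrite iterS {1}/cost_step transitionD.
rewrite (_ : iter N cost_step f = fun x => cost_before N x + iter N (transition P) f x).
  rewrite transitionD addrA; congr (_ + _).
  rewrite /cost_before [RHS]big_ord_recl /=; congr (_ + _).
  elim: N {IH} => [|N IH].
    by rewrite big_ord0 -[RHS](transition0 R n P st); congr transition;
       apply/funext => x; rewrite big_ord0.
  rewrite big_ord_recr /= -IH -transitionD; congr transition.
  by apply/funext => x; rewrite big_ord_recr.
by apply/funext => x; rewrite IH.
Qed.

Lemma cost_beforeE N st : cost_before N st = iter N cost_step (fun=> 0) st.
Proof.
rewrite iter_cost_step; suff -> : iter N (transition P) (fun=> 0) st = 0 by rewrite addr0.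
elim: N st => [//|N IH] st; rewrite iterS -[RHS](transition0 R n P st).
by congr transition; apply/funext => x; rewrite IH.
Qed.

Lemma iter_cost_step_le N f g st : wf_state st ->
  (forall st, wf_state st -> f st <= g st) ->
  iter N cost_step f st <= iter N cost_step g st.
Proof.
move=> wst fg; elim: N st wst => [|N IH] st wst; first exact: fg.
by apply: transition_le => // st' wst'; rewrite lerD2l; apply: IH.
Qed.

Lemma iter_cost_step_value (a s : nat -> nat -> R) N st :
  (forall b k, (b + k < n)%N -> T b.+1 k = a b k /\ S b.+1 k = s b k) ->
  wf_state st ->
  iter N cost_step (cost_to_go (fun _ _ => 0)) st = cost_to_go (value w a s N) st.
Proof.
move=> ha; elim: N st => [//|N IH] st wst.
rewrite iterS /cost_step (_ : transition _ _ _ = transition P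
  (fun x => step_cost w i x + cost_to_go (value w a s N) x) st).
  exact: transition_cost_to_go.
by apply: eq_transition => // st' wst'; rewrite IH.
Qed.

Lemma cost_before_ge0 N st : wf_state st -> 0 <= cost_before N st.
Proof.
rewrite cost_beforeE; elim: N st => [//|N IH] st wst.
rewrite -[leLHS](transition0 R n P st); apply: transition_le => // st' wst'.
by apply: addr_ge0; [exact: cost_ge0|exact: IH].
Qed.

Lemma cost_before_queue N st : wf_state st -> i \in queue st ->
  cost_before N st = w * (minn (index i (queue st)) N)%:R.
Proof.
rewrite cost_beforeE; elim: N st => [|N IH] st wst iq; first by rewrite minn0 mulr0.
have iO : i \notin outside st.
  by case/andP: wst => _ /pred0P /(_ i) /=; rewrite iq /= => ->.
rewrite iterS {1}/cost_step; apply: transition_cst => // E t EO tE.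
have iOE : i \notin outside st :\: E by rewrite inE (negbTE iO) andbF.
have wn := wf_next _ _ _ wst EO tE.
have us := wf_cat_uniq _ _ _ wst EO tE.
have <- : index i (queue st ++ t) = index i (queue st) by rewrite index_cat iq.
have iqt : i \in queue st ++ t by rewrite mem_cat iq.
rewrite /step_cost (negbTE iOE).
case: ifPn => [iq'|].
  rewrite IH //=; move: iq' us iqt => /=; case: (queue st ++ t) => //= x l il.
  case/andP => xl _ _; case: eqVneq => [xi|_]; first by rewrite -xi (negbTE xl) in il.
  by rewrite minnSS -natr1; ring.
move=> /= iq'.
have -> : index i (queue st ++ t) = 0%N.
  by case: (queue st ++ t) iqt iq' => //= x l; rewrite inE; case: eqVneq => //= _ ->.
rewrite min0n mulr0 add0r.
(* Agent [i] was the head and has been processed; from then on he is neither outside nor queued and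
   pays nothing. *)
suff h M st' : i \notin outside st' -> i \notin queue st' ->
    iter M cost_step (fun=> 0) st' = 0 by apply: h.
elim: M st' => [//|M IHM] st' iO' iq''.
rewrite iterS {1}/cost_step; apply: transition_cst => // F v FO vF.
have i1 : i \notin outside (next_state st' F v) by rewrite !inE (negbTE iO') andbF.
have i2 : i \notin queue (next_state st' F v).
  apply/negP => /mem_behead; rewrite mem_cat (negbTE iq'') (perm_mem vF) mem_enum.
  by move/(fintype.subsetP FO); apply/negP.
by rewrite IHM // /step_cost (negbTE i1) (negbTE i2) addr0.
Qed.

(** [value] charges the whole waiting time at entry, hence at least the cost of the first [N] steps.
    Conversely, an agent queued by step [N] is processed within [n] further steps, and one still
    outside is charged nothing beyond step [N]. *)
Lemma value_between (a s : nat -> nat -> R) N st :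
  (forall b k, (b + k < n)%N -> T b.+1 k = a b k /\ S b.+1 k = s b k) ->
  wf_state st ->
  cost_before N st <= cost_to_go (value w a s N) st <= cost_before (N + n) st.
Proof.
move=> ha wst; rewrite -iter_cost_step_value // !cost_beforeE iterD.
apply/andP; split; apply: iter_cost_step_le => // st' wst'.
  exact: cost_to_go_ge0.
rewrite -cost_beforeE /cost_to_go; case: ifP => [_|iO]; first exact: cost_before_ge0.
case: ifP => [iq|_]; last exact: cost_before_ge0.
rewrite cost_before_queue // (minn_idPl _) //.
by apply: leq_trans (wf_card _ wst'); rewrite (leq_trans (index_size _ _)) ?leq_addl.
Qed.

Let iter_cost_ge0 t st : wf_state st ->
  0 <= iter t (transition P) (step_cost w i) st.
Proof.
elim: t st => [|t IH] st wst; first exact: cost_ge0.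
rewrite iterS -[leLHS](transition0 R n P st).
by apply: transition_le.
Qed.

Lemma cost_before_le_expected N :
  ((cost_before N (initial_state n))%:E <= expected_cost w P i)%E.
Proof.
rewrite /cost_before -sumEFin -(big_mkord xpredT
  (fun t => (iter t.+1 (transition P) (step_cost w i) (initial_state n))%:E)).
apply: nneseries_lim_ge => t _ _; rewrite lee_fin; apply: iter_cost_ge0.
exact: wf_initial.
Qed.

Lemma expected_cost_le (B : R) :
  (forall N, cost_before N (initial_state n) <= B) ->
  (expected_cost w P i <= B%:E)%E.
Proof.
move=> hB; apply: lime_le.
  apply: is_cvg_nneseries => t _ _; rewrite lee_fin; apply: iter_cost_ge0.
  exact: wf_initial.
apply: nearW => N.
by rewrite big_mkord sumEFin lee_fin; exact: hB.
Qed.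

End Reduction.
Arguments cost_before {R n}.

(** * The expected cost as the supremum of the value iteration *)

Section ExpectedCost.
Context {R : realType} {n : nat}.
Variables (w : R) (i : 'I_n.+1) (S T : strategy R) (a s : nat -> nat -> R).
Hypotheses (w0 : 0 <= w).
Hypotheses (hS : is_strategy n.+1 S) (hT : is_strategy n.+1 T).
Hypothesis ha : forall b k, (b + k <= n)%N -> T b.+1 k = a b k.
Hypothesis hs : forall b k, (b + k <= n)%N -> S b.+1 k = s b k.

Let P := deviate (symmetric_profile n.+1 S) i T.

Let cost_to_go_initial u :
  cost_to_go w i u (initial_state n.+1) = u n 0%N.
Proof. by rewrite /cost_to_go inE cardsT card_ord. Qed.

Let has b k : (b + k < n.+1)%N -> T b.+1 k = a b k /\ S b.+1 k = s b k.
Proof. by rewrite ltnS => bk; split; [apply: ha|apply: hs]. Qed.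

Lemma value_le_expected N : ((value w a s N n 0)%:E <= expected_cost w P i)%E.
Proof.
apply: le_trans (cost_before_le_expected _ _ _ _ w0 hS hT (N + n.+1)).
have /andP[_ h] := value_between w i S T w0 hS hT a s N (initial_state _) has wf_initial.
by rewrite lee_fin -cost_to_go_initial.
Qed.

Lemma expected_le_value (B : R) : (forall N, value w a s N n 0 <= B) ->
  (expected_cost w P i <= B%:E)%E.
Proof.
move=> hB; apply: expected_cost_le => // N.
have /andP[h _] := value_between w i S T w0 hS hT a s N (initial_state _) has wf_initial.
by apply: (le_trans h); rewrite cost_to_go_initial.
Qed.

End ExpectedCost.

(** * Archimedean and square-root estimates *)

Section Auxiliary.
Context {R : realType}.

Lemma natmul_bounded_le0 (x y : R) : (forall N : nat, N%:R * x <= y) -> x <= 0.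
Proof.
move=> h; rewrite leNgt; apply/negP => x0.
have y0 : 0 <= y by have := h 0%N; rewrite mul0r.
have := h (Num.bound (y / x)); apply/negP; rewrite -ltNge -ltr_pdivrMr //.
by have := archi_boundP (divr_ge0 y0 (ltW x0)).
Qed.

Lemma nondecreasing_bounded_sup (v : nat -> R) (B : R) :
  (forall N, v N <= B) ->
  exists y, [/\ forall N, v N <= y, y <= B &
                forall e, 0 < e -> exists N, y - e < v N].
Proof.
move=> vB; have hs : has_sup (range v).
  by split; [exists (v 0%N), 0%N|exists B => _ [N _ <-]].
exists (sup (range v)); split.
- by move=> N; apply: sup_upper_bound => //; exists N.
- by apply: ge_sup; [exists (v 0%N), 0%N|move=> _ [N _ <-]].
- by move=> e e0; have [_ [N _ <-] ?] := sup_adherent e0 hs; exists N.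
Qed.

Lemma binexp_p0 b (h : nat -> R) : binexp 0 b h = h 0%N.
Proof. by elim: b h => [//|b IH] h /=; rewrite IH; ring. Qed.

(** Comparison with the integral of the square root. With [A], [B] the roots of [m + 1] and [m], so
    that [A^2 - B^2 = 1], the induction step is [(A - B)^2 (2 A + B) >= 0]. *)
Lemma sum_sqrt_le (m : nat) :
  \sum_(j < m) Num.sqrt j%:R <= 2 / 3 * (m%:R * Num.sqrt m%:R) :> R.
Proof.
elim: m => [|m IH]; first by rewrite big_ord0 mul0r mulr0.
rewrite big_ord_recr /=; apply: le_trans (lerD IH (lexx _)) _.
have a2 := sqr_sqrtr (ler0n R m.+1); have b2 := sqr_sqrtr (ler0n R m).
have a0 := sqrtr_ge0 (m.+1%:R : R); have b0 := sqrtr_ge0 (m%:R : R).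
have eq1 : m.+1%:R = m%:R + 1 :> R by rewrite natr1.
move: (Num.sqrt m.+1%:R) (Num.sqrt m%:R) a2 b2 a0 b0 => A B a2 b2 a0 b0.
rewrite -a2 -b2; have : A ^+ 2 - B ^+ 2 = 1 by rewrite a2 b2 eq1; ring.
move=> d; have h : 0 <= (A - B) ^+ 2 * (2 * A + B) by rewrite mulr_ge0 ?sqr_ge0 //; lra.
have -> : B = B * (A ^+ 2 - B ^+ 2) by rewrite d mulr1.
by rewrite d mulr1; nra.
Qed.

(** Here the induction step becomes [(A - B)^2 (A + 2 B) >= 0]. *)
Lemma sum_sqrt_ge (m : nat) :
  2 / 3 * (m%:R * Num.sqrt m%:R) - Num.sqrt m%:R <=
  \sum_(j < m) Num.sqrt j%:R :> R.
Proof.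
elim: m => [|m IH]; first by rewrite big_ord0 sqrtr0; lra.
rewrite big_ord_recr /=; apply: le_trans (lerD IH (lexx _)).
have a2 := sqr_sqrtr (ler0n R m.+1); have b2 := sqr_sqrtr (ler0n R m).
have a0 := sqrtr_ge0 (m.+1%:R : R); have b0 := sqrtr_ge0 (m%:R : R).
have eq1 : m.+1%:R = m%:R + 1 :> R by rewrite natr1.
move: (Num.sqrt m.+1%:R) (Num.sqrt m%:R) a2 b2 a0 b0 => A B a2 b2 a0 b0.
rewrite -a2 -b2; have d : A ^+ 2 - B ^+ 2 = 1 by rewrite a2 b2 eq1; ring.
have h : 0 <= (A - B) ^+ 2 * (A + 2 * B) by rewrite mulr_ge0 ?sqr_ge0 //; lra.
have : A * (A ^+ 2 - B ^+ 2) = A by rewrite d mulr1.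
nra.
Qed.

End Auxiliary.

(** * Lower bound on the optimal symmetric cost *)

Section OptimumLowerBound.
Context {R : realType}.
Variables (w : R) (s : nat -> nat -> R).
Hypotheses (w0 : 0 <= w) (ps : is_prob s).

(** The [- 1] allows for the entering agents, who do not pay the unit cost of waiting in that
    step. *)
Definition opt_lower (m : nat) : R := \sum_(j < m) (Num.sqrt (2 * j%:R * w) - 1).

(** The increments grow with [j], so each agent removed lowers the sum by at most the last
    increment. The bound is affine in [e], so only the mean number of entrants will matter. *)
Lemma opt_lower_concave (m e : nat) : (e <= m.+1)%N ->
  opt_lower m.+1 - e%:R * (Num.sqrt (2 * m%:R * w) - 1) <= opt_lower (m.+1 - e).
Proof.
elim: e => [|e IH] em; first by rewrite mul0r subr0 subn0.
have := IH (ltnW em); have -> : (m.+1 - e = (m.+1 - e.+1).+1)%N by lia.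
rewrite {2}/opt_lower big_ord_recr /= -/(opt_lower _) -natr1.
have : Num.sqrt (2 * (m.+1 - e.+1)%:R * w) <= Num.sqrt (2 * m%:R * w).
  by apply: ler_wsqrtr; apply: ler_wpM2r => //; rewrite ler_pM2l ?ler_nat //; lia.
lra.
Qed.

(* Multiplied by [b + 1], the claim bounds the total cost of all the agents
   outside, and reduces to AM-GM: [q * c <= 1 + q^2 * c^2 / 4]. *)
Lemma opt_lower_subsolution b k :
  opt_lower b.+1 / b.+1%:R <=
  bellman w s s (fun b _ => opt_lower b.+1 / b.+1%:R) b k.
Proof.
have /andP[q0 q1] := ps b k; rewrite /bellman; set q := s b k in q0 q1 *.
have b0 : 0 < b.+1%:R :> R by rewrite ltr0n.
rewrite ler_pdivrMr //; set A := binexp _ _ _.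
(* The agents bear equal shares, so [binexp_fail_bias] adds up the shares of those who stay out to
   the total [opt_lower]; if all enter, both sides vanish. *)
have eqA : (1 - q) * b.+1%:R * A = binexp q b.+1 (fun e => opt_lower (b.+1 - e)).
  rewrite [(1 - q) * _]mulrC binexp_fail_bias; apply: eq_binexp => e.
  rewrite leq_eqVlt => /orP[/eqP ->|eb].
    by rewrite subnn mul0r /opt_lower big_ord0.
  by rewrite -subSn // mulrC divfK // pnatr_eq0 subn_eq0 -ltnNge.
set c := Num.sqrt (2 * b%:R * w).
have geA : opt_lower b.+1 - b.+1%:R * q * (c - 1) <= (1 - q) * b.+1%:R * A.
  rewrite eqA; apply: le_trans (binexp_le _ _ _ _ _ (opt_lower_concave b)) => //; last first.
    by apply/andP.
  rewrite binexpD binexp_cst.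
  rewrite (_ : (fun e : nat => - _) = fun e : nat => - (c - 1) * e%:R); last first.
    by apply/funext => e; rewrite mulNr mulrC.
  by rewrite binexpZ binexp_mean; lra.
have c2 : c ^+ 2 = 2 * b%:R * w by rewrite sqr_sqrtr // !mulr_ge0.
have k0 : 0 <= q * (b.+1%:R * (w * k%:R)) by rewrite !mulr_ge0 // ltW.
have key : 0 <= b.+1%:R * (1 - q * c / 2) ^+ 2 by rewrite mulr_ge0 ?sqr_ge0 ?ltW.
have e1 : b.+1%:R * (1 - q * c / 2) ^+ 2 =
   b.+1%:R * (1 - q * c + q ^+ 2 * (b%:R * w) / 2).
  by rewrite sqrrB expr1n expr_div_n exprMn c2; field.
rewrite e1 in key; nra.
Qed.

End OptimumLowerBound.

(** * A nearly optimal symmetric strategy *)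

Section OptimumUpperBound.
Context {R : realType}.
Variables (w : R) (n : nat).
Hypothesis w_ge : 4 * n.+1%:R <= w.

(* The square root minimizes 1 / p + b w p / 2, the leading part of the total
   cost of moving from b + 1 to b outside agents. *)
Definition near_opt (b k : nat) : R :=
  if (k == 0%N) && (b <= n)%N then
    if b == 0%N then 1 else Num.sqrt (2 / (b%:R * w))
  else 0.

Definition opt_upper (m : nat) : R :=
  \sum_(j < m) (Num.sqrt (2 * j%:R * w) + 4 * j.+1%:R).

Let w_gt0 : 0 < w.
Proof. by apply: lt_le_trans w_ge; rewrite mulr_gt0. Qed.

(** At most one entrant is expected even among all [b + 1] agents. This makes [near_opt] a
    probability and keeps the cost of collisions within the linear terms of [opt_upper]. *)
Lemma near_opt_small b : (0 < b)%N -> (b <= n)%N ->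
  b.+1%:R * Num.sqrt (2 / (b%:R * w)) <= 1.
Proof.
move=> b0 bn; have b1 : 1 <= b%:R :> R by rewrite ler1n.
have bw : 0 < b%:R * w by rewrite mulr_gt0 // ltr0n.
rewrite -(@ler_pXn2r _ 2) ?nnegrE // ?mulr_ge0 ?sqrtr_ge0 //.
rewrite exprMn sqr_sqrtr; last by rewrite divr_ge0 // ltW.
rewrite expr1n mulrA ler_pdivrMr // mul1r.
have bnR : b%:R <= n%:R :> R by rewrite ler_nat.
move: w_ge; rewrite -!natr1 => ww.
have : b%:R * (4 * (b%:R + 1)) <= b%:R * w by apply: ler_wpM2l; lra.
nra.
Qed.

Lemma near_opt_prob : is_prob near_opt.
Proof.
move=> b k; rewrite /near_opt; case: ifP => [/andP[_ bn]|_]; last by rewrite lexx ler01.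
case: eqP => [_|/eqP]; first by rewrite ler01 lexx.
rewrite -lt0n => b0; rewrite sqrtr_ge0 /=.
have := near_opt_small _ b0 bn; have := sqrtr_ge0 (2 / (b%:R * w)).
have : 1 <= b.+1%:R :> R by rewrite ler1n.
nra.
Qed.

Lemma opt_upper_homo m m' : (m <= m')%N -> opt_upper m <= opt_upper m'.
Proof.
move=> mm; rewrite /opt_upper -!(big_mkord xpredT
  (fun j : nat => Num.sqrt (2 * j%:R * w) + 4 * j.+1%:R)).
rewrite (big_cat_nat (leq0n m) mm) /= lerDl; apply: sumr_ge0 => j _.
by rewrite addr_ge0 ?sqrtr_ge0 // mulr_ge0.
Qed.

Lemma opt_upper_supersolution b k : (b <= n)%N ->
  bellman w near_opt near_opt (fun b k => k%:R + opt_upper b.+1 / b.+1%:R) b k <=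
  k%:R + opt_upper b.+1 / b.+1%:R.
Proof.
move=> bn; have b0 : 0 < b.+1%:R :> R by rewrite ltr0n.
rewrite /bellman; case: k => [|k]; last first.
  (* While the queue is nonempty everybody waits, at cost 1 per step: this is the summand [k%:R]. *)
  by rewrite /near_opt /= mul0r subr0 add0r mul1r binexp_p0 /= subn0 addn0 -natr1; lra.
have /andP[p0 p1] := near_opt_prob b 0%N.
rewrite add0r.
have G0 : 0 <= opt_upper b.+1.
  by have := opt_upper_homo _ _ (leq0n b.+1); rewrite {1}/opt_upper big_ord0.
move: p0 p1; rewrite /near_opt eqxx bn /=; case: (posnP b) => [b_0|b_0].
  (* The last agent enters the empty queue at once and pays nothing. *)
  by move=> _ _; rewrite b_0 mul0r mul0r mulr0 mul1r subrr mul0r addr0 add0r -b_0 divr_ge0.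
set p := Num.sqrt _ => p0 p1.
have pb : b.+1%:R * p <= 1 := near_opt_small _ b_0 bn.
have b1 : 1 <= b%:R :> R by rewrite ler1n.
have bw : 0 < b%:R * w by rewrite mulr_gt0 // ltr0n.
have p2 : p ^+ 2 * (b%:R * w) = 2.
  by rewrite sqr_sqrtr ?divfK ?gt_eqF // divr_ge0 // ltW.
set c := Num.sqrt (2 * b%:R * w).
have pc : p * c = 2.
  rewrite -sqrtrM ?divr_ge0 // ?ltW // (_ : _ * _ = 2 ^+ 2).
    by rewrite sqrtr_sqr ger0_norm.
  by field; rewrite !gt_eqF // ltr0n.
set E := binexp _ _ _.
have hE : E <= b%:R * p + binexp p b (fun e => opt_upper (b - e).+1 / (b - e).+1%:R).
  rewrite -binexp_mean -binexpD; apply: binexp_le; first by apply/andP.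
  by move=> e _; rewrite lerD2r ler_nat leq_pred.
set H := binexp p b (fun e => opt_upper _ / _) in hE.
have eqH : (1 - p) * b.+1%:R * H = binexp p b.+1 (fun e => opt_upper (b.+1 - e)).
  rewrite [(1 - p) * _]mulrC binexp_fail_bias; apply: eq_binexp => e.
  rewrite leq_eqVlt => /orP[/eqP ->|eb].
    by rewrite subnn mul0r /opt_upper big_ord0.
  by rewrite -subSn // mulrC divfK // pnatr_eq0 subn_eq0 -ltnNge.
set G := opt_upper b.+1 in G0 *; set G' := opt_upper b.
have GE : G = G' + (c + 4 * b.+1%:R) by rewrite /G /opt_upper big_ord_recr.
set P0 := (1 - p) ^+ b.+1.
(* Only if nobody enters, with probability [P0], does the bound stay at [G]; any entry lowers it to
   [G'] or less. *)
have leH : (1 - p) * b.+1%:R * H <= G' + (G - G') * P0.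
  rewrite eqH /P0 -binexp_eq0 -binexpZ -[X in X + _](binexp_cst p b.+1) -binexpD.
  apply: binexp_le; first by apply/andP.
  case=> [|e] _ /=; first by rewrite subn0 mulr1 addrC subrK.
  by rewrite mulr0 addr0; apply: opt_upper_homo; rewrite subSS leq_subr.
have hP : P0 * (1 + b.+1%:R * p) <= 1 by apply: onem_exp_le; apply/andP.
rewrite ?mulr0n !add0r ler_pdivlMr //.
have step1 : (p * (w * (b%:R * p / 2)) + (1 - p) * (1 + E)) * b.+1%:R <=
    b.+1%:R * (2 + b%:R * p) + (G' + (G - G') * P0).
  have -> : p * (w * (b%:R * p / 2)) = 1 by lra.
  have : (1 - p) * b.+1%:R * E <= (1 - p) * b.+1%:R * (b%:R * p + H).
    by apply: ler_wpM2l => //; apply: mulr_ge0; [lra|exact: ltW].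
  have : 0 <= p * b.+1%:R * (1 + b%:R * p).
    by apply: mulr_ge0; [apply: mulr_ge0 => //; apply: ltW|nra].
  move: leH; nra.
apply: (le_trans step1).
have D0 : 0 <= G - G' by rewrite GE addrC addKr addr_ge0 ?sqrtr_ge0.
(* With [y = b p <= x = (b + 1) p <= 1] one has [(2 + y) (1 + x) <= 2 + 4 x]; this is the origin of
   the 4 in [opt_upper]. *)
have step2 : b.+1%:R * (2 + b%:R * p) <= (G - G') * (1 - P0).
  have x0 : 0 <= b.+1%:R * p by rewrite mulr_ge0 // ltW.
  have : (G - G') * (b.+1%:R * p) <= (G - G') * (1 - P0) * (1 + b.+1%:R * p).
    by rewrite -mulrA; apply: ler_wpM2l => //; nra.
  have -> : (G - G') * (b.+1%:R * p) = b.+1%:R * (2 + 4 * (b.+1%:R * p)).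
    by rewrite GE -pc; ring.
  move=> h; have h1 : 0 < 1 + b.+1%:R * p by lra.
  rewrite -(ler_pM2r h1); apply: le_trans h.
  rewrite -mulrA; apply: ler_wpM2l; first exact: ltW.
  have : b%:R * p <= b.+1%:R * p by rewrite -natr1; nra.
  have : 0 <= b%:R * p by apply: mulr_ge0 => //; lra.
  nra.
lra.
Qed.

End OptimumUpperBound.

(** * Upper bound on the equilibrium cost *)

Section EquilibriumUpperBound.
Context {R : realType}.
Variables (w : R) (s : nat -> nat -> R).
Hypotheses (w_gt0 : 0 < w) (ps : is_prob s).

Definition eq_bound (b : nat) : R := Num.sqrt (w * b.+1%:R) + b.+1%:R.

(** A deviation that secures [eq_bound] whatever the others play: enter an empty queue exactly when
    this costs no more than the bound. *)
Definition threshold (b k : nat) : R :=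
  ((k == 0%N) && (w * (b%:R * s b 0 / 2) <= eq_bound b))%:R.

Lemma threshold_prob : is_prob threshold.
Proof. by move=> b k; rewrite /threshold ler0n lern1 leq_b1. Qed.

(** The linear term of [eq_bound] pays for the steps in which the [e] entrants are processed. *)
Lemma eq_bound_sub b e : (e <= b)%N -> e%:R + eq_bound (b - e) <= eq_bound b.
Proof.
move=> eb; rewrite /eq_bound.
have : Num.sqrt (w * (b - e).+1%:R) <= Num.sqrt (w * b.+1%:R).
  by apply: ler_wsqrtr; rewrite ler_pM2l // ler_nat ltnS leq_subr.
have -> : b.+1%:R = e%:R + (b - e).+1%:R :> R by rewrite -natrD; congr (_%:R); lia.
lra.
Qed.

(* If entering costs more than [eq_bound b], then the others enter so often that
   waiting for them costs at most [eq_bound b - eq_bound b.-1]. *)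
Lemma eq_bound_supersolution b k :
  bellman w threshold s (fun b k => k%:R + eq_bound b) b k <= k%:R + eq_bound b.
Proof.
have /andP[q0 q1] := ps b k; rewrite /bellman; case: k q0 q1 => [|k] q0 q1; last first.
  rewrite /threshold /= mul0r subr0 add0r mul1r -[X in _ <= X + _]natr1.
  rewrite [leRHS](_ : _ = 1 + (k%:R + eq_bound b)); last ring.
  rewrite lerD2l -[leRHS](binexp_cst (s b k.+1) b); apply: binexp_le.
    by apply/andP.
  by move=> e eb; rewrite /= natrD -addrA lerD2l eq_bound_sub.
rewrite /threshold eqxx /= mulr0n !add0r.
case: (lerP (w * (b%:R * s b 0 / 2)) (eq_bound b)) => hb.
  by rewrite /= mulr1n mul1r subrr mul0r addr0.
rewrite /= mulr0n mul0r subr0 mul1r add0r; set p := s b 0 in q0 q1 hb *.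
have b_0 : (0 < b)%N.
  rewrite lt0n; apply: contraTneq hb => ->; rewrite mul0r mul0r mulr0 -leNgt.
  by rewrite addr_ge0 ?sqrtr_ge0.
case: b b_0 @p q0 q1 hb => // b _ p q0 q1 hb.
set D := eq_bound b.+1 - eq_bound b.
have hE : binexp p b.+1 (fun e => (0 + e).-1%:R + eq_bound (b.+1 - e)) <=
    eq_bound b + D * (1 - p) ^+ b.+1.
  rewrite -binexp_eq0 -binexpZ -[X in _ <= X + _](binexp_cst p b.+1) -binexpD.
  apply: binexp_le; first by apply/andP.
  case=> [|e] eb /=; first by rewrite subn0 mulr1 /D; lra.
  by rewrite mulr0 addr0 subSS eq_bound_sub.
have : (1 - p) ^+ b.+1 * (1 + b.+1%:R * p) <= 1 by apply: onem_exp_le; apply/andP.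
set x := b.+1%:R * p in hb *; set P0 := (1 - p) ^+ b.+1 in hE * => hP.
set A := Num.sqrt (w * b.+2%:R); set B := Num.sqrt (w * b.+1%:R).
have A2 : A ^+ 2 = w * b.+2%:R by rewrite sqr_sqrtr // mulr_ge0 // ltW.
have B2 : B ^+ 2 = w * b.+1%:R by rewrite sqr_sqrtr // mulr_ge0 // ltW.
have A0 : 0 <= A := sqrtr_ge0 _; have B0 : 0 <= B := sqrtr_ge0 _.
have AB2 : A ^+ 2 - B ^+ 2 = w by rewrite A2 B2 -[b.+2%:R]natr1; ring.
have AB : B < A by rewrite ltr_sqrt ?ltr_pM2l ?ltr_nat // mulr_gt0.
have DE : D = 1 + (A - B) by rewrite /D /eq_bound -/A -/B -[b.+2%:R]natr1; ring.
have xA : 2 * A < w * x.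
  by move: hb; rewrite /eq_bound -/A; have : 0 <= b.+2%:R :> R by []; lra.
have x0 : 0 < x by rewrite -(pmulr_rgt0 _ w_gt0); lra.
(* This combines [w x > 2 A] with [A^2 - B^2 = w] and [2 A >= A + B]. *)
have xAB : 1 <= x * (A - B).
  rewrite -(ler_pM2l w_gt0) mulr1 mulrA.
  have : 2 * A * (A - B) <= w * x * (A - B) by apply: ler_wpM2r; lra.
  nra.
have Dx : 1 + x <= x * D by rewrite DE; lra.
have x1 : 0 < 1 + x by lra.
have : 1 <= (1 - P0) * D.
  rewrite -(ler_pM2l x1) mulr1; apply: (le_trans Dx); rewrite mulrA.
  by apply: ler_wpM2r; [rewrite DE; lra|nra].
rewrite /D in hE *; lra.
Qed.

End EquilibriumUpperBound.

(** * Lower bound on the equilibrium cost *)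

Section EquilibriumLowerBound.
Context {R : realType}.
Variables (w W : R) (s : nat -> nat -> R) (n : nat).
Hypotheses (W_ge : 8 * n.+1%:R ^+ 2 < W) (wW : w = W ^+ 2) (ps : is_prob s).

(** The equilibrium condition in terms of upper bounds on the iterates, so that no cost is
    presupposed finite. *)
Hypothesis best_response : forall a, is_prob a -> forall B,
  (forall N, value w a s N n 0 <= B) -> forall N, value w s s N n 0 <= B.

Let W_gt0 : 0 < W.
Proof. by apply: le_lt_trans W_ge; rewrite mulr_ge0. Qed.

Let w_gt0 : 0 < w. Proof. by rewrite wW exprn_gt0. Qed.
Let w_ge0 : 0 <= w. Proof. exact: ltW. Qed.

Let v := value w s s.

Lemma equilibrium_le N : v N n 0 <= eq_bound w n.
Proof.
apply: (best_response (threshold w s)); first exact: threshold_prob.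
move=> M.
have := value_le_super w (threshold w s) s (threshold_prob w s) ps n
  (fun b k => k%:R + eq_bound w b) M n 0.
rewrite add0r; apply => //.
  by move=> b k _; rewrite !addr_ge0 ?sqrtr_ge0.
by move=> b k _; apply: eq_bound_supersolution.
Qed.

(* Every state (j, 0) with m <= j is reached with positive probability. *)
Definition on_path m := forall j, (m < j <= n)%N -> 0 < s j 0 < 1.

Let prob1 (j : nat) : R := j.+1%:R * s j.+1 0 * (1 - s j.+1 0) ^+ j.

Let prob1E j : binexp (s j.+1 0) j.+1 (fun e => (e == 1%N)%:R) = prob1 j.
Proof. exact: binexp_eq1. Qed.

Let prob1_gt0 m j : on_path m -> (m <= j < n)%N -> 0 < prob1 j.
Proof.
move=> pm mj; have /andP[p0 p1] : 0 < s j.+1 0 < 1 by apply: pm; lia.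
by rewrite /prob1 mulr_gt0 ?exprn_gt0 ?mulr_gt0 // subr_gt0.
Qed.

(* A deviation at the single state (m, 0) that gains there gains at the
   initial state too, since (m, 0) is reached with positive probability. *)
Lemma path_deviation m a M d : (m <= n)%N -> on_path m -> is_prob a ->
  (forall b k, (b, k) != (m, 0)%N -> a b k = s b k) -> 0 < d ->
  ~ (forall N, value w a s N m 0 <= v (N + M) m 0 - d).
Proof.
move=> mn pm pa as_ d0 hd.
have val_le N b k : value w a s N b k <= v (N + M) b k.
  elim: N b k => [|N IH] b k; first exact: value_ge0.
  have [[-> ->]|ne] := eqVneq (b, k) (m, 0)%N.
    by apply: le_trans (hd _) _; rewrite lerBlDr lerDl ltW.
  apply: le_trans (bellman_le w a s pa ps _ _ b k (fun b' k' _ => IH b' k')) _.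
  by rewrite addSn /v valueS /bellman as_.
(* The gain passes from [(j, 0)] to [(j + 1, 0)] through the event that exactly one other agent
   enters: he is processed at once and the queue is empty again. *)
have h j : (m <= j <= n)%N -> exists d' M', [/\ 0 < d', (M <= M')%N &
    forall N, value w a s N j 0 <= v (N + M') j 0 - d'].
  elim: j => [|j IH] mj.
    have m0 : m = 0%N by lia.
    by exists d, M; split=> //; rewrite m0 in hd.
  have [mj'|mj'] := eqVneq m j.+1; first by exists d, M; rewrite -mj'.
  have mj2 : (m <= j < n)%N by lia.
  have /andP[p0 p1] : 0 < s j.+1 0 < 1 by apply: pm; lia.
  have P1 := prob1_gt0 _ _ pm mj2.
  have [|d' [M' [d'0 MM' hd']]] := IH; first by lia.
  exists ((1 - s j.+1 0) * prob1 j * d'), M'.+1; split=> [||N].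
  - by apply: mulr_gt0 => //; apply: mulr_gt0 => //; rewrite subr_gt0.
  - exact: ltnW.
  apply: (le_trans (value_homo w a s w_ge0 pa ps N N.+1 _ _ (leqnSn N))).
  rewrite addnS /v !valueS /bellman as_; last first.
    by apply: contraNneq mj' => -[<-].
  rewrite -addrA lerD2l -mulrA -mulrBr.
  apply: ler_wpM2l; first by lra.
  rewrite -addrA lerD2l lerBrDr mulrC -prob1E -binexpZ -binexpD.
  apply: binexp_le => // -[|[|e]] ej.
  - rewrite mulr0 addr0; apply: le_trans (val_le _ _ _) _.
    by apply: value_homo => //; rewrite leq_add2l.
  - by rewrite mulr1 subSS subn0 add0n /= -lerBrDr hd'.
  - rewrite mulr0 addr0; apply: le_trans (val_le _ _ _) _.
    by apply: value_homo => //; rewrite leq_add2l.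
have [|d' [M' [d'0 _ hd']]] := h n; first by rewrite mn leqnn.
(* Every upper bound on the equilibrium cost could be lowered by [d']. Repeated from [eq_bound w n],
   this contradicts nonnegativity. *)
have drop B : (forall N, v N n 0 <= B) -> forall N, v N n 0 <= B - d'.
  move=> hB; apply: (best_response a) => // N; apply: le_trans (hd' N) _.
  by rewrite lerD2r.
have iterd K : forall N, v N n 0 <= eq_bound w n - K%:R * d'.
  elim: K => [|K IH] N; first by rewrite mul0r subr0 equilibrium_le.
  by have := drop _ IH N; rewrite -natr1; lra.
suff : d' <= 0 by rewrite leNgt d'0.
apply: (natmul_bounded_le0 _ (eq_bound w n)) => K.
by have := iterd K 0%N; rewrite /v /= ; lra.
Qed.

Let point (m : nat) (x : R) (b k : nat) : R :=
  if (b, k) == (m, 0)%N then x else s b k.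

Let point_prob m x : 0 <= x <= 1 -> is_prob (point m x).
Proof. by move=> x01 b k; rewrite /point; case: ifP. Qed.

Let point_ne m x b k : (b, k) != (m, 0)%N -> point m x b k = s b k.
Proof. by rewrite /point => /negbTE ->. Qed.

Let cont N m : R := 1 + binexp (s m 0) m (fun e => v N (m - e)%N (0 + e).-1).

Section IndifferentState.
Variables (m : nat) (y : R).
Hypotheses (mn : (m <= n)%N) (pm : on_path m) (p01 : 0 < s m 0 < 1).
Hypothesis vy : forall N, v N m 0 <= y.
Hypothesis y_sup : forall e, 0 < e -> exists N, y - e < v N m 0.

Let entry : R := w * (0%:R + m%:R * s m 0 / 2).

(** Otherwise entering with certainty at [(m, 0)] is a gain of at least [(y - entry) / 2] over the
    iterates close to their supremum [y]. *)
Lemma entry_ge : y <= entry.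
Proof.
rewrite leNgt; apply/negP => ey.
have d0 : 0 < (y - entry) / 2 by lra.
have [M hM] := y_sup _ d0.
have p1 : is_prob (point m 1) by apply: point_prob; rewrite ler01 lexx.
apply: (path_deviation m (point m 1) M _ mn pm p1 (point_ne m 1) d0) => N.
have h : value w (point m 1) s N m 0 <= entry.
  case: N => [|N]; first exact: entry_cost_ge0.
  by rewrite valueS /bellman /point eqxx subrr mul0r addr0 mul1r.
apply: le_trans h _.
have := value_homo w s s w_ge0 ps ps M (N + M) m 0 (leq_addl _ _).
rewrite -/v; lra.
Qed.

Let indiff N : s m 0 * entry + (1 - s m 0) * cont N m <= y.
Proof. by have := vy N.+1; rewrite /v valueS. Qed.

Lemma cont_le N : cont N m <= y.
Proof.
have := indiff N; have := entry_ge; case/andP: p01 => p0 p1 ey h.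
have : s m 0 * y <= s m 0 * entry by apply: ler_wpM2l => //; apply: ltW.
move=> h2; rewrite -(@ler_pM2l _ (1 - s m 0)); lra.
Qed.

(** Otherwise waiting beats [y] by a fixed [eta], since the mixture of both actions costs at most
    [y]; never entering at [(m, 0)] is then a gain of [eta / 4]. *)
Lemma entry_le : entry <= y.
Proof.
rewrite leNgt; apply/negP => ey; case/andP: (p01) => p0 p1.
have q0 : 0 < 1 - s m 0 by lra.
set eta := s m 0 / (1 - s m 0) * (entry - y).
have eta0 : 0 < eta by rewrite mulr_gt0 ?divr_gt0 // subr_gt0.
have hc N : cont N m <= y - eta.
  rewrite -(ler_pM2l q0) mulrBr /eta mulrA mulrC [_ / _]mulrC mulrA divff ?gt_eqF //.
  by have := indiff N; lra.
have e40 : 0 < eta / 4 by lra.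
have [M hM] := y_sup _ e40.
have vM N : y - eta / 4 < v (N + M) m 0.
  apply: lt_le_trans hM _.
  exact: (value_homo w s s w_ge0 ps ps M (N + M) m 0 (leq_addl _ _)).
have pp : is_prob (point m 0) by apply: point_prob; rewrite lexx ler01.
(* The number of other outside agents never grows, so the deviation at [(m, 0)] cannot be noticed
   from below [m]. *)
have below N b k : (b < m)%N -> value w (point m 0) s N b k = v N b k.
  elim: N b k => [//|N IH] b k bm; rewrite /v !valueS /bellman point_ne; last first.
    by apply: contraTneq bm => -[->]; rewrite ltnn.
  congr (_ + _ * (1 + _)); apply: eq_binexp => e _; apply: IH.
  by rewrite (leq_ltn_trans (leq_subr _ _)).
(* The two iterations differ only if nobody enters and [(m, 0)] recurs; there [vM] keeps the error
   within [eta / 4]. *)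
have hval N : value w (point m 0) s N m 0 <= y - eta / 2.
  elim: N => [|N IH].
    have := hc 0%N; have : 0 <= cont 0 m.
      by rewrite /cont binexp_cst addr0.
    by rewrite /=; lra.
  rewrite valueS /bellman {1 2}/point eqxx mul0r add0r subr0 mul1r.
  have := hc (N + M)%N; rewrite /cont.
  have P01 : 0 <= (1 - s m 0) ^+ m <= 1.
    by rewrite exprn_ge0 ?exprn_ile1 //; lra.
  have : binexp (s m 0) m
      (fun e => value w (point m 0) s N (m - e)%N (0 + e).-1) <=
    binexp (s m 0) m (fun e => v (N + M) (m - e)%N (0 + e).-1) +
      eta / 4 * (1 - s m 0) ^+ m.
    rewrite -binexp_eq0 -binexpZ -binexpD; apply: binexp_le => // -[|e] em.
      by rewrite mulr1 subn0 addn0 /=; have := vM N; lra.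
    rewrite mulr0 addr0 below; last by rewrite ltn_subrL (leq_ltn_trans _ em).
    exact: (value_homo w s s w_ge0 ps ps N (N + M) _ _ (leq_addr _ _)).
  have : eta / 4 * (1 - s m 0) ^+ m <= eta / 4.
    by case/andP: P01 => _ h; rewrite -[leRHS]mulr1; apply: ler_wpM2l => //; lra.
  lra.
apply: (path_deviation m (point m 0) M _ mn pm pp (point_ne m 0) e40) => N.
by have := hval N; have := vM N; lra.
Qed.

End IndifferentState.

(* Applied with A = sqrt (m + 2), B = sqrt (m + 1), x = (m + 1) p, and c the lower
   bound on the cost in the state (m, 0). *)
Lemma equilibrium_increment (A B x c : R) :
  1 <= B -> A ^+ 2 = B ^+ 2 + 1 -> 0 < A -> A ^+ 2 <= n.+1%:R ->
  0 < x -> W * (B - 1) <= c ->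
  1 + x * (1 - x) * c <= x * (w * x / 2) -> x <= 1 ->
  W * (A - 1) <= w * x / 2.
Proof.
move=> B1 AB A0 An x0 hc h x1; rewrite leNgt; apply/negP => lt.
have c0 : 0 <= W * (B - 1) by apply: mulr_ge0; [exact: ltW|lra].
have h1 : 1 + x * (1 - x) * (W * (B - 1)) <= x * (w * x / 2).
  apply: le_trans h; rewrite lerD2l; apply: ler_wpM2l => //.
  by apply: mulr_ge0; lra.
have AltB : B < A by rewrite -(@ltr_pXn2r _ 2) ?nnegrE //; [rewrite AB; lra|lra|lra].
(* In terms of [X], [h1] reads [1 + X (B - 1) - X^2 (B - 1) / W <= X^2 / 2]. This fails for
   [X < 2 (A - 1)]: [k1] leaves a margin of [A - B], and by [small] the error term is below
   [1 / (2 A) <= A - B]. *)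
set X := W * x; have X0 : 0 < X by rewrite mulr_gt0.
have Xlt : X < 2 * (A - 1).
  rewrite -(ltr_pM2l W_gt0); move: lt; rewrite wW /X; lra.
have WA4 : 8 * A ^+ 4 < W.
  apply: le_lt_trans W_ge; rewrite ler_pM2l //.
  have -> : A ^+ 4 = A ^+ 2 ^+ 2 by rewrite -exprM.
  by rewrite ler_pXn2r ?nnegrE ?sqr_ge0.
have eqX : x * (w * x / 2) = X ^+ 2 / 2 by rewrite wW /X; lra.
have eqX2 : x * (1 - x) * (W * (B - 1)) = X * (B - 1) - X ^+ 2 * (B - 1) / W.
  by rewrite /X; field; rewrite gt_eqF.
rewrite eqX eqX2 in h1.
have small : X ^+ 2 * (B - 1) / W < 1 / (2 * A).
  rewrite ltr_pdivrMr //.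
  have : X ^+ 2 * (B - 1) <= 4 * A ^+ 2 * A.
    apply: ler_pM; rewrite ?sqr_ge0 //; try lra.
    have -> : 4 * A ^+ 2 = (2 * A) ^+ 2 by rewrite exprMn; ring.
    by rewrite -subr_ge0 subr_sqr; apply: mulr_ge0; lra.
  move=> h2; apply: le_lt_trans h2 _.
  rewrite mul1r [ltRHS]mulrC ltr_pdivlMr ?mulr_gt0 //.
  by apply: le_lt_trans WA4; rewrite le_eqVlt; apply/orP; left; apply/eqP; ring.
have d1 : (A - B) * (A + B) = 1 by rewrite -subr_sqr AB; ring.
have dA : 1 / (2 * A) <= A - B.
  rewrite ler_pdivrMr ?mulr_gt0 //.
  have : (A - B) * (A + B) <= (A - B) * (2 * A) by apply: ler_wpM2l; lra.
  lra.
have dle1 : A - B <= 1.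
  have : (A - B) * 1 <= (A - B) * (A + B) by apply: ler_wpM2l; lra.
  lra.
have k1 : X ^+ 2 / 2 - X * (B - 1) <= 1 - (A - B).
  have e1 : 2 * (A - 1) * (A - B) = 1 + (A - B) ^+ 2 - 2 * (A - B).
    by rewrite -[X in X + _ - _]d1; ring.
  have e2 : (A - B) ^+ 2 <= A - B.
    by rewrite expr2 -[leRHS]mulr1; apply: ler_wpM2l; lra.
  have [neg|pos] := lerP (X / 2 - (B - 1)) 0.
    have : X * (X / 2 - (B - 1)) <= 0 by rewrite mulr_ge0_le0 // ltW.
    lra.
  have : X * (X / 2 - (B - 1)) <= 2 * (A - 1) * (A - B).
    by apply: ler_pM; lra.
  lra.
lra.
Qed.

(** Induction on [m]. Entering with probability 0 or 1 at [(m + 1, 0)] is settled directly;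
    otherwise the path extends to [(m, 0)] and indifference equates the cost with that of
    entering. *)
Lemma equilibrium_ge_on_path m : (m <= n)%N -> on_path m ->
  forall y, (forall N, v N m 0 <= y) -> W * (Num.sqrt m.+1%:R - 1) <= y.
Proof.
elim: m => [|m IH] mn pm y0 vy0.
  by rewrite sqrtr1 subrr mulr0; apply: le_trans (vy0 0%N).
have [y [vy yy0 y_sup]] := nondecreasing_bounded_sup _ _ vy0.
apply: (le_trans _ yy0) => {y0 vy0 yy0}.
set p := s m.+1 0; have /andP[] := ps m.+1 0; rewrite -/p => p0 p1.
have m0 : 1 <= m.+1%:R :> R by rewrite ler1n.
set B : R := Num.sqrt m.+1%:R; set A : R := Num.sqrt m.+2%:R.
have B2 : B ^+ 2 = m.+1%:R by rewrite sqr_sqrtr.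
have A2 : A ^+ 2 = m.+2%:R by rewrite sqr_sqrtr.
have A0 : 0 < A by rewrite sqrtr_gt0.
have B1 : 1 <= B by rewrite -sqrtr1 ler_wsqrtr.
have A1 : 1 <= A by rewrite -sqrtr1 ler_wsqrtr // ler1n.
have Ale : A <= m.+2%:R by rewrite -A2 expr2 ler_peMl // ltW.
have [p_0|p_gt0] := eqVneq p 0.
  (* If nobody ever enters, the cost is unbounded. *)
  have vN N : v N m.+1 0 = N%:R.
    elim: N => [//|N IHN].
    rewrite /v valueS /bellman -/p p_0 mul0r add0r subr0 mul1r binexp_p0 /=.
    by rewrite -/v subn0 IHN -natr1 addrC.
  suff : (1 : R) <= 0 by rewrite ler10.
  by apply: (natmul_bounded_le0 _ y) => N; rewrite mulr1 -vN.
have W8 : 8 < W.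
  apply: le_lt_trans W_ge; rewrite ler_peMr // exprn_ege1 // ler1n //.
have [p_1|p_lt1] := eqVneq p 1.
  (* If all enter at once, the entry cost [w (m + 1) / 2] already exceeds the claimed bound. *)
  have := vy 1%N; rewrite /v /value /= /bellman -/p p_1 mul1r subrr mul0r addr0 add0r mulr1.
  apply: le_trans; rewrite wW expr2 -mulrA ler_pM2l //.
  have : 8 * (m.+1%:R / 2) <= W * (m.+1%:R / 2) by apply: ler_wpM2r; lra.
  move: Ale; rewrite -[m.+2%:R]natr1; lra.
have p01 : 0 < s m.+1 0 < 1 by rewrite !lt_neqAle eq_sym p_gt0 p0 p_lt1 p1.
have yE : w * (0%:R + m.+1%:R * p / 2) = y.
  apply/eqP; rewrite eq_le; apply/andP; split.
    exact: entry_le.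
  exact: entry_ge.
have pm' : on_path m.
  move=> j jm; have [->//|jm'] := eqVneq j m.+1; apply: pm.
  by case/andP: jm => mj ->; rewrite andbT ltn_neqAle eq_sym jm'.
have prob : 0 < prob1 m by apply: (prob1_gt0 m); rewrite ?leqnn.
set P0 := (1 - p) ^+ m.+1.
have P00 : 0 <= P0 by rewrite exprn_ge0 // subr_ge0.
(* Only the outcomes with no entrant or exactly one are kept; the other continuation costs are
   nonnegative. *)
have cont_ge N : 1 + P0 * v N m.+1 0 + prob1 m * v N m 0 <= y.
  apply: le_trans (cont_le _ _ mn pm p01 vy y_sup N).
  rewrite /cont -addrA lerD2l [P0 * _]mulrC [prob1 m * _]mulrC.
  rewrite /P0 -binexp_eq0 -prob1E -!binexpZ -binexpD.
  apply: (binexp_le _ _ _ _ (ps m.+1 0)) => -[|[|e]] em.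
  - by rewrite mulr0 addr0 mulr1 subn0.
  - by rewrite mulr0 add0r mulr1 subSS subn0.
  - by rewrite !mulr0 addr0; apply: value_ge0.
(* The limit of [cont_ge]: solved for [v N m 0], it gives an upper bound to which the induction
   hypothesis applies. *)
have key : 1 + P0 * y + prob1 m * (W * (B - 1)) <= y.
  apply/ler_addgt0Pr => e e0.
  have e0' : 0 < e / (1 + P0) by rewrite divr_gt0 //; lra.
  have [M hM] := y_sup _ e0'.
  have : W * (B - 1) <= (y - 1 - P0 * (y - e / (1 + P0))) / prob1 m.
    apply: IH => // [|N]; first exact: ltnW.
    apply: (le_trans (value_homo w s s w_ge0 ps ps N (N + M) _ _ (leq_addr _ _))).
    rewrite ler_pdivlMr // mulrC; have := cont_ge (N + M)%N.
    have : P0 * (y - e / (1 + P0)) <= P0 * v (N + M) m.+1 0.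
      apply: ler_wpM2l => //; apply: le_trans (ltW hM) _.
      exact: (value_homo w s s w_ge0 ps ps M (N + M) _ _ (leq_addl _ _)).
    rewrite -/v; lra.
  rewrite ler_pdivlMr //.
  have : P0 * (e / (1 + P0)) <= e.
    rewrite mulrA ler_pdivrMr; last lra.
    by rewrite mulrC; apply: ler_wpM2l; lra.
  lra.
set x := m.+1%:R * p.
have x0 : 0 < x by rewrite mulr_gt0 // lt_def p_gt0.
have yx : y = w * x / 2 by rewrite -yE /x add0r mulrA.
have P0x : 1 - x <= P0 := onem_exp_ge _ _ (ps m.+1 0).
rewrite yx.
(* For [x > 1] the cost [w x / 2] exceeds [W^2 / 2], which is more than enough because [W] is
   large. *)
have [x1|x1] := lerP x 1; last first.
  apply: (@le_trans _ _ (W * (W / 2))).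
    rewrite ler_pM2l //.
    have : m.+2%:R <= n.+1%:R :> R by rewrite ler_nat.
    have : n.+1%:R <= n.+1%:R ^+ 2 :> R by rewrite expr2 ler_peMl // ler1n.
    move: (n.+1%:R : R) (m.+2%:R : R) Ale W_ge W_gt0 => c d.
    lra.
  by rewrite mulrA -expr2 -wW ler_pM2r // ler_peMr // ltW.
apply: (equilibrium_increment A B x (W * (B - 1))) => //.
- by rewrite A2 B2 natr1.
- by rewrite A2 ler_nat.
rewrite -yx.
have y_ge0 : 0 <= y by apply: le_trans (vy 0%N); rewrite /v.
have : (1 - P0) * y <= x * y by apply: ler_wpM2r => //; lra.
have : x * (1 - x) <= prob1 m.
  rewrite /prob1 -/p -/x ler_pM2l //.
  have : 1 - m%:R * p <= (1 - p) ^+ m := onem_exp_ge _ _ (ps m.+1 0).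
  by rewrite /x -natr1; lra.
have c0 : 0 <= W * (B - 1) by apply: mulr_ge0; [exact: ltW|lra].
move=> /(ler_wpM2r c0); lra.
Qed.

Lemma equilibrium_ge y : (forall N, v N n 0 <= y) ->
  W * (Num.sqrt n.+1%:R - 1) <= y.
Proof. by apply: equilibrium_ge_on_path => // j; lia. Qed.

End EquilibriumLowerBound.

(** * Equilibrium and optimal costs in the game *)

Section Costs.
Context {R : realType} {n : nat}.
Implicit Types (S T : strategy R) (w : R).

(** Yields probabilities also at the states about which [is_strategy] says nothing, and shifts from
    the outside agents to the other outside agents. *)
Definition clip S (b k : nat) : R := Num.max 0 (Num.min 1 (S b.+1 k)).

Lemma clip_prob S : is_prob (clip S).
Proof.
by move=> b k; rewrite /clip le_max lexx /= ge_max ler01 ge_min lexx.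
Qed.

Lemma clipE S b k : is_strategy n.+1 S -> (b + k <= n)%N -> S b.+1 k = clip S b k.
Proof.
move=> hS bk; have /andP[S0 S1] := hS b.+1 k (ltn0Sn b) bk.
by rewrite /clip (min_idPr S1) (max_idPr S0).
Qed.

Definition strategy_of (a : nat -> nat -> R) : strategy R := fun m k => a m.-1 k.

Lemma strategy_ofP a : is_prob a -> is_strategy n.+1 (strategy_of a).
Proof. by move=> pa m k _ _; apply: pa. Qed.

Lemma deviate_self S i :
  deviate (symmetric_profile n.+1 S) i S = symmetric_profile n.+1 S.
Proof. by apply/funext => j; rewrite /deviate; case: ifP. Qed.

Section Symmetric.
Variables (w : R) (i : 'I_n.+1) (S : strategy R).
Hypotheses (w0 : 0 <= w) (hS : is_strategy n.+1 S).

Lemma symmetric_cost_ge N :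
  ((value w (clip S) (clip S) N n 0)%:E <=
   expected_cost w (symmetric_profile n.+1 S) i)%E.
Proof.
by rewrite -(deviate_self S i); apply: value_le_expected => // b k; apply: clipE.
Qed.

Lemma symmetric_cost_le B : (forall N, value w (clip S) (clip S) N n 0 <= B) ->
  (expected_cost w (symmetric_profile n.+1 S) i <= B%:E)%E.
Proof.
move=> hB; rewrite -(deviate_self S i).
by apply: expected_le_value hB => // b k; apply: clipE.
Qed.

Lemma deviation_cost_le a B : is_prob a ->
  (forall N, value w a (clip S) N n 0 <= B) ->
  (expected_cost w (deviate (symmetric_profile n.+1 S) i (strategy_of a)) i
     <= B%:E)%E.
Proof.
move=> pa hB; apply: expected_le_value hB => //; first exact: strategy_ofP.
by move=> b k; apply: clipE.
Qed.

Lemma symmetric_cost_lower_bound :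
  ((opt_lower w n.+1 / n.+1%:R)%:E <=
   expected_cost w (symmetric_profile n.+1 S) i)%E.
Proof.
set f := fun b _ : nat => opt_lower w b.+1 / b.+1%:R.
set M := Num.sqrt (2 * n%:R * w) + 1.
have M0 : 0 < M by rewrite ltr_wpDl ?sqrtr_ge0.
have fM b k : (b <= n)%N -> f b k <= M.
  move=> bn; rewrite ler_pdivrMr ?ltr0n // /opt_lower.
  apply: (@le_trans _ _ (\sum_(j < b.+1) M)); last first.
    by rewrite sumr_const card_ord mulr_natr.
  apply: ler_sum => j _; rewrite /M.
  have : Num.sqrt (2 * j%:R * w) <= Num.sqrt (2 * n%:R * w).
    apply: ler_wsqrtr; apply: ler_wpM2r => //; rewrite ler_pM2l // ler_nat.
    by rewrite (leq_trans _ bn) // -ltnS ltn_ord.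
  lra.
have h N : N%:R / (N%:R + M) * f n 0%N <= value w (clip S) (clip S) N n 0.
  apply: (value_ge_sub w _ _ w0 (clip_prob S) (clip_prob S) n M f) => // b k _.
  exact: (opt_lower_subsolution w (clip S) w0 (clip_prob S) b k).
have := symmetric_cost_ge.
case: (expected_cost _ _ _) => [c| |] hc; last 2 first.
- by rewrite leey.
- by have := hc 0%N.
(* Letting [N] grow removes the factor [N / (N + M)]: with [f] the claimed bound, [N (f - c) <= M c]
   for all [N]. *)
rewrite lee_fin -subr_le0; apply: (natmul_bounded_le0 _ (M * c)) => N.
have NM0 : 0 < N%:R + M by rewrite ltr_wpDl.
have := le_trans (h N) (hc N); rewrite mulrAC ler_pdivrMr // -/(f n 0%N); lra.
Qed.

End Symmetric.

Lemma near_opt_cost_le w (i : 'I_n.+1) : 4 * n.+1%:R <= w ->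
  (expected_cost w (symmetric_profile n.+1 (strategy_of (near_opt w n))) i <=
   (opt_upper w n.+1 / n.+1%:R)%:E)%E.
Proof.
move=> ww; have pq := near_opt_prob w n ww.
have w0 : 0 <= w by apply: le_trans ww; rewrite mulr_ge0.
have clip_of : clip (strategy_of (near_opt w n)) = near_opt w n.
  apply/funext => b; apply/funext => k.
  have /andP[a0 a1] := pq b k.
  by rewrite /clip /strategy_of /= (min_idPr a1) (max_idPr a0).
apply: symmetric_cost_le => //; first exact: strategy_ofP.
move=> N; rewrite clip_of.
have := value_le_super w _ _ pq pq n
  (fun b k => k%:R + opt_upper w b.+1 / b.+1%:R) N n 0.
rewrite add0r; apply => //.
  move=> b k _; rewrite addr_ge0 // divr_ge0 //.
  by have := opt_upper_homo w 0 b.+1 (leq0n _); rewrite {1}/opt_upper big_ord0.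
by move=> b k bn; apply: opt_upper_supersolution.
Qed.

Lemma equilibrium_cost_bounds (w W : R) (i : 'I_n.+1) S :
  8 * n.+1%:R ^+ 2 < W -> w = W ^+ 2 -> symmetric_equilibrium n.+1 w S ->
  exists c : R, [/\ expected_cost w (symmetric_profile n.+1 S) i = c%:E,
    W * (Num.sqrt n.+1%:R - 1) <= c & c <= W * Num.sqrt n.+1%:R + n.+1%:R].
Proof.
move=> W_ge wW [hS eqS].
have W0 : 0 < W by apply: le_lt_trans W_ge; rewrite mulr_ge0.
have w0 : 0 <= w by rewrite wW sqr_ge0.
have pS := clip_prob S.
have best a : is_prob a -> forall B, (forall N, value w a (clip S) N n 0 <= B) ->
    forall N, value w (clip S) (clip S) N n 0 <= B.
  move=> pa B hB N; rewrite -lee_fin.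
  apply: (le_trans (symmetric_cost_ge w i S w0 hS N)).
  apply: (le_trans (eqS i _ (strategy_ofP _ pa))).
  exact: deviation_cost_le.
have up := equilibrium_le w W (clip S) n W_ge wW pS best.
have := symmetric_cost_le w i S w0 hS _ up.
have := symmetric_cost_ge w i S w0 hS.
case: (expected_cost _ _ _) => [c| |] lec cle; last 2 first.
- by move: cle; rewrite leye_eq.
- by have := lec 0%N.
exists c; split=> //.
  exact: (equilibrium_ge w W (clip S) n W_ge wW pS best).
move: cle; rewrite lee_fin /eq_bound wW.
by rewrite sqrtrM ?sqr_ge0 // sqrtr_sqr ger0_norm // ltW.
Qed.

Lemma optimal_cost_bounds (w W : R) :
  8 * n.+1%:R ^+ 2 < W -> w = W ^+ 2 ->
  exists y : R, [/\ optimal_social_cost n.+1 w = y%:E,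
    Num.sqrt 2 * W * \sum_(j < n.+1) Num.sqrt j%:R - n.+1%:R <= y &
    y <= Num.sqrt 2 * W * \sum_(j < n.+1) Num.sqrt j%:R + 4 * n.+1%:R ^+ 2].
Proof.
move=> W_ge wW.
have W0 : 0 < W by apply: le_lt_trans W_ge; rewrite mulr_ge0.
have w0 : 0 <= w by rewrite wW sqr_ge0.
have n0 : (0 : R) < n.+1%:R by rewrite ltr0n.
have ww : 4 * n.+1%:R <= w.
  have n1 : (1 : R) <= n.+1%:R by rewrite ler1n.
  rewrite wW; nra.
have sqE (j : nat) : Num.sqrt (2 * j%:R * w) = Num.sqrt 2 * W * Num.sqrt j%:R.
  by rewrite wW sqrtrM ?mulr_ge0 // sqrtr_sqr gtr0_norm // sqrtrM // mulrAC.
set Z := \sum_(j < n.+1) Num.sqrt j%:R.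
have lowE : opt_lower w n.+1 = Num.sqrt 2 * W * Z - n.+1%:R.
  rewrite /opt_lower big_split /= sumr_const card_ord mulNrn; congr (_ - _).
  by rewrite /Z mulr_sumr; apply: eq_bigr => j _; rewrite sqE.
have upE : opt_upper w n.+1 <= Num.sqrt 2 * W * Z + 4 * n.+1%:R ^+ 2.
  rewrite /opt_upper big_split /= /Z mulr_sumr; apply: lerD.
    by apply: ler_sum => j _; rewrite sqE.
  rewrite -mulr_sumr ler_pM2l // expr2 mulr_natr -[X in _ *+ X](card_ord n.+1).
  by rewrite -sumr_const; apply: ler_sum => j _; rewrite ler_nat.
have social (S : strategy R) (x : R) : is_strategy n.+1 S ->
    (x%:E <= expected_cost w (symmetric_profile n.+1 S) ord0)%E ->
    ((n.+1%:R * x)%:E <= social_cost n.+1 w S)%E.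
  by move=> hS h; rewrite (social_costE w S ord0) EFinM lee_pmul2l // ltr0n.
have lower : ((opt_lower w n.+1)%:E <= optimal_social_cost n.+1 w)%E.
  apply: le_ereal_inf_tmp => _ [S hS <-].
  have := social S _ hS (symmetric_cost_lower_bound w ord0 S w0 hS).
  by rewrite mulrCA mulfV ?mulr1 // gt_eqF.
have upper : (optimal_social_cost n.+1 w <= (opt_upper w n.+1)%:E)%E.
  set Q := strategy_of (near_opt w n).
  apply: (@le_trans _ _ (social_cost n.+1 w Q)).
    apply: ereal_inf_lbound => /=; exists Q => //.
    exact/strategy_ofP/near_opt_prob.
  rewrite (social_costE w Q ord0).
  apply: (@le_trans _ _ (n.+1%:R%:E * (opt_upper w n.+1 / n.+1%:R)%:E)%E).
    by rewrite lee_pmul2l // near_opt_cost_le.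
  by rewrite -EFinM mulrCA mulfV ?mulr1 // gt_eqF.
move: lower upper; case: (optimal_social_cost _ _) => [y| |] //.
rewrite !lee_fin lowE => ly yu; exists y; split => //.
exact: le_trans yu upE.
Qed.

End Costs.

(** * The ratio of the two costs *)

Section Ratio.
Context {R : realType}.

(* [D = sqrt n], [Z] is the sum of [sqrt j] for [j < n], and [r = sqrt 2];
   [X] and [Y] are the equilibrium and the optimal cost. *)
Lemma ratio_bound (W D Z r X Y : R) :
  2 <= D ^+ 2 -> 0 < D -> r ^+ 2 = 2 -> 1 <= r -> 8 * D ^+ 4 < W ->
  2 / 3 * D ^+ 3 - D <= Z -> Z <= 2 / 3 * D ^+ 3 ->
  D ^+ 2 * (W * (D - 1)) <= X -> X <= D ^+ 2 * (W * D + D ^+ 2) ->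
  r * W * Z - D ^+ 2 <= Y -> Y <= r * W * Z + 4 * D ^+ 4 ->
  0 < Y /\ `|X / Y - 3 / (2 * r)| <= 48 / D.
Proof.
move=> D2 D0 r2 r1 WD Z1 Z2 X1 X2 Y1 Y2.
have D1 : 1 <= D by rewrite -(@ler_pXn2r _ 2) ?nnegrE ?expr1n //; lra.
have r32 : r <= 3 / 2.
  by rewrite -(@ler_pXn2r _ 2) ?nnegrE //; rewrite ?r2; lra.
have D3 : D ^+ 3 = D ^+ 2 * D by rewrite exprSr.
have D4 : D ^+ 4 = D ^+ 2 * D ^+ 2 by rewrite -exprD.
have D4ge : D ^+ 2 * 2 <= D ^+ 4 by rewrite D4; apply: ler_wpM2l; lra.
have W0 : 0 < W by lra.
have D3ge : 2 * D <= D ^+ 3 by rewrite D3; apply: ler_wpM2r; lra.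
have Zge : D ^+ 3 / 6 <= Z by lra.
have Z0 : 0 <= Z by lra.
have WZ : W * (D ^+ 3 / 6) <= W * Z by apply: ler_wpM2l; lra.
have rWZ : W * Z <= r * W * Z.
  by rewrite -mulrA -[leLHS]mul1r; apply: ler_wpM2r => //; apply: mulr_ge0; lra.
have WD3 : W * 2 <= W * D ^+ 3 by apply: ler_wpM2l; lra.
have Yge : W * D ^+ 3 / 12 <= Y by lra.
have Y0 : 0 < Y by lra.
split=> //.
have r0 : 0 < r by lra.
have rne : r != 0 by rewrite gt_eqF.
set al := 3 / (2 * r).
have alr : al * r = 3 / 2 by rewrite /al; field.
have al0 : 0 <= al by rewrite divr_ge0 //; lra.
have al32 : al <= 3 / 2.
  by rewrite ler_pdivrMr; [lra|lra].
have -> : X / Y - al = (X - al * Y) / Y by field; rewrite gt_eqF.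
rewrite normrM [`|Y^-1|]gtr0_norm ?invr_gt0 // ler_pdivrMr //.
(* The constant is [48 = 4 * 12]: the numerator will be at most [4 W D^2] in absolute value, and [Y]
   is at least [W D^3 / 12]. *)
have K : 4 * (W * D ^+ 2) <= 48 / D * Y.
  have -> : 4 * (W * D ^+ 2) = 48 / D * (W * D ^+ 3 / 12).
    by rewrite D3; field; rewrite gt_eqF.
  by apply: ler_wpM2l => //; rewrite divr_ge0 // ltW.
apply: le_trans K.
have aY1 : al * (r * W * Z - D ^+ 2) <= al * Y by apply: ler_wpM2l.
have aY2 : al * Y <= al * (r * W * Z + 4 * D ^+ 4) by apply: ler_wpM2l.
have e1 : al * (r * W * Z) = 3 / 2 * (W * Z) by rewrite -alr; ring.
have aD2 : al * D ^+ 2 <= 3 / 2 * D ^+ 2 by apply: ler_wpM2r; lra.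
have aD4 : al * D ^+ 4 <= 3 / 2 * D ^+ 4 by apply: ler_wpM2r; lra.
have WZ1 : W * (2 / 3 * D ^+ 3 - D) <= W * Z by apply: ler_wpM2l; lra.
have WZ2 : W * Z <= W * (2 / 3 * D ^+ 3) by apply: ler_wpM2l; lra.
have WDD : W * D <= W * D ^+ 2.
  by apply: ler_wpM2l; [lra|rewrite expr2; nra].
have WDD2 : W * 2 <= W * D ^+ 2 by apply: ler_wpM2l; lra.
have X1' : W * D ^+ 3 - W * D ^+ 2 <= X by apply: le_trans X1; rewrite D3; lra.
have X2' : X <= W * D ^+ 3 + D ^+ 4 by apply: le_trans X2 _; rewrite D3 D4; lra.
rewrite ler_norml; apply/andP; split; lra.
Qed.

End Ratio.

Theorem theorem1p4 (R : realType) :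
  exists K : R, 0 < K /\
    forall n : nat, (2 <= n)%N ->
      exists w0 : R, forall w : R, 1 < w -> w0 < w ->
        forall S : strategy R, symmetric_equilibrium n w S ->
          (`| social_cost n w S / optimal_social_cost n w
              - (3 / (2 * Num.sqrt 2))%:E | <= (K / Num.sqrt n%:R)%:E)%E.
Proof.
exists 48; split=> // -[//|n] n2.
(* This makes the square root [W] of [w] exceed [8 n^2], with [n] the number of agents. *)
exists ((8 * n.+1%:R ^+ 2) ^+ 2) => w w1 w_gt S eqS.
have w0 : 0 < w by apply: lt_trans w1.
set W := Num.sqrt w.
have wW : w = W ^+ 2 by rewrite sqr_sqrtr // ltW.
have W_ge : 8 * n.+1%:R ^+ 2 < W.
  rewrite -(@ltr_pXn2r _ 2) ?nnegrE ?sqrtr_ge0 ?mulr_ge0 //.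
  by rewrite -wW.
have [c [cE c1 c2]] := equilibrium_cost_bounds w W ord0 S W_ge wW eqS.
have [y [yE y1 y2]] := @optimal_cost_bounds R n w W W_ge wW.
rewrite (social_costE w S ord0) cE yE -EFinM.
have D2 : Num.sqrt n.+1%:R ^+ 2 = n.+1%:R :> R by rewrite sqr_sqrtr.
have D4 : Num.sqrt n.+1%:R ^+ 4 = n.+1%:R ^+ 2 :> R by rewrite -[in RHS]D2 -exprM.
have D3 : Num.sqrt n.+1%:R ^+ 3 = n.+1%:R * Num.sqrt n.+1%:R :> R.
  by rewrite exprSr D2.
have n0 : (0 : R) < n.+1%:R by rewrite ltr0n.
have [|||||||||||y0 h] := @ratio_bound R W (Num.sqrt n.+1%:R)
  (\sum_(j < n.+1) Num.sqrt j%:R) (Num.sqrt 2) (n.+1%:R * c) y;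
  rewrite ?D2 ?D3 ?D4 //.
- by rewrite ler_nat.
- by rewrite sqr_sqrtr.
- by rewrite -[leLHS]sqrtr1 ler_wsqrtr // ler1n.
- exact: sum_sqrt_ge.
- exact: sum_sqrt_le.
- by rewrite ler_pM2l.
- by rewrite ler_pM2l.
by rewrite inver gt_eqF // -EFinM -EFinB abse_EFin lee_fin.
Qed.
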